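(* Let $a,b\in\mathbb{P}$, $(\alpha,\beta)\in\mathrm{BP}(a,b)$, $l\in\mathbb{N}$, and let $\prec_{b-a}$ be a $(b-a)$-order on $\mathbb{Z}$. Then $$|\mathrm{OP}(a,b,\alpha,\beta,l)|=\sum_{\eta\in\mathrm{OT}(\lambda_{a,b,\alpha,\beta},l)}\binom{\min(a,b)+\mathcal{A}(\prec_{b-a},\eta)}{l}.$$
   Context: Notation: $\mathbb{P}$ is the set of positive integers, $\mathbb{N}$ the set of nonnegative integers, $[m,n]=\{m,m+1,\ldots,n\}$ ($=\emptyset$ if $n<m$), $[n]=[1,n]$. Osculating paths. For $a,b\in\mathbb{P}$, $[a]\times[b]$ is a rectangle of lattice points with matrix labelling ($(i,j)$ is in row $i$ from the top and column $j$ from the left). $\mathrm{BP}(a,b)$ is the set of pairs $(\alpha,\beta)$ with $\alpha\subset[a]$, $\beta\subset[b]$, $|\alpha|=|\beta|$; elements are labelled in increasing order, $\alpha=\{\alpha_1<\ldots<\alpha_r\}$, $\beta=\{\beta_1<\ldots<\beta_r\}$. For $x\in[a]$, $y\in[b]$, $\Pi(a,b,x,y)$ is the set of paths $Q=(Q_0,\ldots,Q_L)$ with $Q_0=(a,y)$, $Q_L=(x,b)$ and each step $Q_m-Q_{m-1}\in\{(0,1),(-1,0)\}$. For $x<x'$ and $y<y'$, paths $Q\in\Pi(a,b,x,y)$ and $Q'\in\Pi(a,b,x',y')$ are osculating if whenever $Q_m=Q'_{m'}=(i,j)$, then $Q_{m-1}=(i,j-1)$, $Q_{m+1}=(i-1,j)$,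 $Q'_{m'-1}=(i+1,j)$ (unless $m'=0$) and $Q'_{m'+1}=(i,j+1)$ (unless $Q'_{m'}$ is the last point of $Q'$). $\mathrm{OP}(a,b,\alpha,\beta)$ is the set of $r$-tuples $P=(P_1,\ldots,P_r)$ with $P_k\in\Pi(a,b,\alpha_k,\beta_k)$ and $P_k,P_{k+1}$ osculating for each $k\in[r-1]$. $Z(P)$ is the set of all points of $[a]\times[b]$ through which either no path of $P$ passes (vacancies) or two paths of $P$ pass (osculations). $\mathrm{OP}(a,b,\alpha,\beta,l)$ is the set of $P\in\mathrm{OP}(a,b,\alpha,\beta)$ with $|Z(P)|=l$. Partitions. A partition is a weakly decreasing infinite sequence $\lambda=(\lambda_1,\lambda_2,\ldots)$ of nonnegative integers with finitely many nonzero terms; $\ell(\lambda)$ is the number of nonzero terms, $\lambda^t$ the conjugate, $Y(\lambda)=\{(i,j)\in\mathbb{P}^2\mid i\le\ell(\lambda),\,j\le\lambda_i\}$, and $\emptyset$ is the empty partition. For integers $\gamma_1>\ldots>\gamma_r\ge0$ and $\delta_1>\ldots>\delta_r\ge0$, $(\gamma_1,\ldots,\gamma_r\,|\,\delta_1,\ldots,\delta_r)$ (Frobenius notation) is the unique partition $\lambda$ with exactly $r$ indices $i$ satisfying $\lambda_i\ge i$, and with $\lambda_i-i=\gamma_i$, $\lambda^t_i-i=\delta_i$ for $i\in[r]$. For $\lambda$ with $\ell(\lambda)\le a$ and $\lambda_1\le b$, $[a]\times[b]\setminus\lambda:=(b-\lambda_a,b-\lambda_{a-1},\ldots,b-\lambda_1)$.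 For $(\alpha,\beta)\in\mathrm{BP}(a,b)$, $\lambda_{a,b,\alpha,\beta}:=[a]\times[b]\setminus(b-\beta_1,\ldots,b-\beta_r\,|\,a-\alpha_1,\ldots,a-\alpha_r)$. Partitions $\lambda,\mu$ differ by a square, $\lambda\sim\mu$, if one of $Y(\lambda),Y(\mu)$ is the disjoint union of the other and a single point $(i,j)$; then $\Delta(\lambda,\mu):=j-i$. Oscillating tableaux. $\mathrm{OT}(\lambda,l)$ is the set of sequences $\eta=(\eta_0=\emptyset,\eta_1,\ldots,\eta_l=\lambda)$ of partitions with $\eta_{k-1}\sim\eta_k$ for $k\in[l]$. For $\eta\in\mathrm{OT}(\lambda,l)$, $\Omega(\eta)_k=\Delta(\eta_{k-1},\eta_k)$ for $k\in[l]$. For a strict total order $\prec$ on $\mathbb{Z}$, $\mathcal{A}(\prec,\eta):=|\{k\in[l-1]\mid\Omega(\eta)_k\prec\Omega(\eta)_{k+1}\}|$ is the number of ascents of $\eta$ with respect to $\prec$. For $q\in\mathbb{Z}$, a $q$-order is a strict total order $\prec_q$ on $\mathbb{Z}$ such that $z\prec_q z'$ whenever $z<z'\le q$ or $z>z'\ge q$. Binomial coefficients $\binom{m}{l}$ with $0\le m<l$ are $0$. *)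

(* Defs.v *)
From mathcomp Require Import all_boot all_order all_algebra finmap.
From mathcomp Require Import all_classical zify.

Local Open Scope classical_set_scope.
Local Open Scope nat_scope.
Local Open Scope card_scope.

(* The element of rank k (1 <= k <= r) of {s_1 < ... < s_r}. *)
Definition elt (s : {fset nat}) (k : nat) : nat :=
  nth 0 (sort leq (enum_fset s)) k.-1.

Definition BP (a b : nat) : set ({fset nat} * {fset nat}) :=
  [set ab | [/\ forall i, i \in ab.1 -> 1 <= i <= a,
                forall j, j \in ab.2 -> 1 <= j <= b
              & #|` ab.1| = #|` ab.2| ] ].

(* Osculating paths.  Points are pairs (row, column), numbered from 1, with
   row 1 at the top; a path is the sequence Q_0, ..., Q_L of its points. *)

Definition path_step (p q : nat * nat) : bool :=
  (q == (p.1, p.2.+1)) || (p == (q.1.+1, q.2)).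

Definition paths (a b x y : nat) : set (seq (nat * nat)) :=
  [set Q | exists2 Q', Q = (a, y) :: Q' &
     path path_step (a, y) Q' /\ last (a, y) Q' = (x, b)].

Definition osculating (Q Q' : seq (nat * nat)) : Prop :=
  forall m m' i j, onth Q m = Some (i, j) -> onth Q' m' = Some (i, j) ->
  [/\ 0 < m /\ onth Q m.-1 = Some (i, j.-1),
      onth Q m.+1 = Some (i.-1, j),
      0 < m' -> onth Q' m'.-1 = Some (i.+1, j)
    & m'.+1 < size Q' -> onth Q' m'.+1 = Some (i, j.+1)].

Definition Zset (a b : nat) (P : seq (seq (nat * nat))) : set (nat * nat) :=
  [set p | [/\ 1 <= p.1 <= a, 1 <= p.2 <= b &
     let n := count (fun Q => p \in Q) P in n = 0 \/ n = 2] ].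

(* The k-th path of P, 1 <= k <= r. *)
Definition kth_path (P : seq (seq (nat * nat))) (k : nat) :=
  nth [::] P k.-1.

Definition OP (a b : nat) (alpha beta : {fset nat}) :
    set ((#|` alpha|).-tuple (seq (nat * nat))) :=
  [set P |
    (forall k, 1 <= k <= #|` alpha| ->
       paths a b (elt alpha k) (elt beta k) (kth_path P k)) /\
    (forall k, 1 <= k <= #|` alpha|.-1 ->
       osculating (kth_path P k) (kth_path P k.+1))].

Definition OPl (a b : nat) (alpha beta : {fset nat}) (l : nat) :
    set ((#|` alpha|).-tuple (seq (nat * nat))) :=
  [set P | OP a b alpha beta P /\ Zset a b P #= `I_l].

(* Partitions.  The sequence (lambda_1, lambda_2, ...) is stored from index 0:
   lambda_i is [part lambda i] = lambda i.-1, for i >= 1. *)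

Notation natseq := {fsfun nat -> nat with 0}.

Definition part (lam : natseq) (i : nat) : nat := lam i.-1.

Definition is_partition (lam : natseq) : Prop :=
  forall i, 1 <= i -> part lam i.+1 <= part lam i.

Definition empty_part : natseq := [fsfun with 0].

Definition part_length (lam : natseq) : nat := #|` finsupp lam|.

(* lambda^t_j is the number of i with lambda_i >= j, for j >= 1. *)
Definition conj_part (lam : natseq) (j : nat) : nat :=
  #|` [fset i in finsupp lam | j <= lam i]%fset|.

Definition Young (lam : natseq) : set (nat * nat) :=
  [set p | [/\ 1 <= p.1, 1 <= p.2, p.1 <= part_length lam
             & p.2 <= part lam p.1] ].

(* gamma and delta list gamma_1 > ... > gamma_r and delta_1 > ... > delta_r;
   existence and uniqueness are [frobeniusP] and [frobenius_unique]. *)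
Definition is_frobenius (gamma delta : seq nat) (lam : natseq) : Prop :=
  let r := size gamma in
  [/\ is_partition lam,
      [set i | 1 <= i /\ i <= part lam i] #= `I_r
    & forall i, 1 <= i <= r ->
        ((part lam i)%:Z - i%:Z = (nth 0%N gamma i.-1)%:Z)%R /\
        ((conj_part lam i)%:Z - i%:Z = (nth 0%N delta i.-1)%:Z)%R].

Definition frobenius (gamma delta : seq nat) : natseq :=
  xget empty_part [set lam | is_frobenius gamma delta lam].

(* (b - lambda_a, ..., b - lambda_1), for lambda with at most a nonzero parts
   and lambda_1 <= b. *)
Definition complement (a b : nat) (lam : natseq) : natseq :=
  [fsfun i in [fset k in iota 0 a]%fset => b - part lam (a - i)].

Definition lambda_of (a b : nat) (alpha beta : {fset nat}) : natseq :=
  complement a b (frobenius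
    [seq b - elt beta k | k <- iota 1 #|` beta|]
    [seq a - elt alpha k | k <- iota 1 #|` alpha|]).

(* Oscillating tableaux *)

Definition differ_at (lam mu : natseq) (p : nat * nat) : Prop :=
  (Young lam = Young mu `|` [set p] /\ ~ Young mu p) \/
  (Young mu = Young lam `|` [set p] /\ ~ Young lam p).

Definition differ_by_square (lam mu : natseq) : Prop :=
  exists p, differ_at lam mu p.

(* Meaningful only when [differ_by_square lam mu]; the point p is then unique
   ([differ_at_unique]). *)
Definition Delta (lam mu : natseq) : int :=
  let p := xget (0, 0) [set p | differ_at lam mu p] in
  (p.2%:Z - p.1%:Z)%R.

(* eta_k, 0 <= k <= l *)
Definition eta_at {l : nat} (eta : l.+1.-tuple natseq) (k : nat) : natseq :=
  nth empty_part eta k.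

Definition OT (lam : natseq) (l : nat) : set (l.+1.-tuple natseq) :=
  [set eta | [/\ forall k, k <= l -> is_partition (eta_at eta k),
                 eta_at eta 0 = empty_part,
                 eta_at eta l = lam
               & forall k, 1 <= k <= l ->
                   differ_by_square (eta_at eta k.-1) (eta_at eta k)] ].

Definition Omega {l : nat} (eta : l.+1.-tuple natseq) (k : nat) : int :=
  Delta (eta_at eta k.-1) (eta_at eta k).

Definition ascents (prec : rel int) {l : nat} (eta : l.+1.-tuple natseq) : nat :=
  count (fun k => prec (Omega eta k) (Omega eta k.+1)) (iota 1 l.-1).

Definition strict_total_order (prec : rel int) : Prop :=
  [/\ irreflexive prec, transitive prec
    & forall z z', z != z' -> prec z z' || prec z' z].

Definition q_order (q : int) (prec : rel int) : Prop :=
  strict_total_order prec /\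
  forall z z' : int,
    ((z < z')%R && (z' <= q)%R) || ((z > z')%R && (z' >= q)%R) -> prec z z'.

(* Well-definedness of the notions above *)

Lemma is_partitionP lam : is_partition lam ->
  forall i j, i <= j -> lam j <= lam i.
Proof.
move=> dec i j; elim: j => [|j IH]; first by rewrite leqn0 => /eqP ->.
rewrite leq_eqVlt => /predU1P[-> //|]; rewrite ltnS => /IH; apply: leq_trans.
exact: (dec j.+1).
Qed.

Lemma fsfun_ub (lam : natseq) : exists n, forall t, n <= t -> lam t = 0.
Proof.
exists (\sum_(i <- finsupp lam) i.+1) => t le_t.
apply: fsfun_dflt; apply/negP => t_in; move: le_t.
by rewrite (big_fsetD1 t)//=; lia.
Qed.

Lemma card_iota (n : nat) (S : {fset nat}) :
  (forall t, (t \in S) = (t < n)) -> #|` S| = n.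
Proof.
move=> SE; rewrite -[RHS](size_iota 0 n); apply/perm_size/uniq_perm.
- exact: fset_uniq.
- exact: iota_uniq.
- by move=> t; rewrite SE mem_iota.
Qed.

Lemma leq_part_conj lam : is_partition lam ->
  forall j t, 0 < j -> (j <= lam t) = (t < conj_part lam j).
Proof.
move=> dec j t j_gt0; have [n0 n0P] := fsfun_ub lam.
have ex : exists n, lam n < j by exists n0; rewrite n0P.
case: (ex_minnP ex) => n lt_n min_n.
have leE s : (j <= lam s) = (s < n).
  apply/idP/idP => [le_s|lt_s].
    rewrite ltnNge; apply/negP => le_ns.
    by have := is_partitionP _ dec _ _ le_ns; lia.
  by rewrite leqNgt; apply/negP => /min_n; lia.
rewrite leE /conj_part (@card_iota n)// => s.
rewrite !inE mem_finsupp /=; have := leE s.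
by case: (s < n) => /=; lia.
Qed.

Lemma card_iota1 (n : nat) : [set i | 1 <= i <= n] #= `I_n.
Proof.
have -> : [set i | 1 <= i <= n] = [set` [fset k in iota 1 n]%fset].
  by apply/seteqP; split=> i /=; rewrite !inE mem_iota; lia.
apply/card_eq_fsetP; rewrite -[RHS](size_iota 1 n); apply/perm_size/uniq_perm.
- exact: fset_uniq.
- exact: iota_uniq.
- by move=> t; rewrite inE.
Qed.

Lemma card_eq_initial (A : set nat) (r : nat) :
  (forall i j, 1 <= i -> i <= j -> A j -> A i) -> (forall i, A i -> 1 <= i) ->
  A #= `I_r -> forall i, 1 <= i -> A i <-> i <= r.
Proof.
move=> down pos Ar i i1; split=> [Ai|le_ir].
  have : [set k | 1 <= k <= i] #<= A.
    apply: subset_card_le => k /= /andP[k1 ki]; exact: down Ai.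
  by rewrite (card_le_eqr Ar) (card_le_eql (card_iota1 i)) card_le_II.
apply: contrapT => nAi.
have : A #<= [set k | 1 <= k <= i.-1].
  apply: subset_card_le => k Ak /=; rewrite (pos _ Ak) /=.
  suff: k < i by lia.
  by rewrite ltnNge; apply/negP => le_ik; apply: nAi; exact: down le_ik Ak.
by rewrite (card_le_eql Ar) (card_le_eqr (card_iota1 _)) card_le_II; lia.
Qed.

Lemma count_initial (A : pred nat) (r : nat) :
  (forall i j, i <= j -> j < r -> A j -> A i) ->
  forall i, i < r -> (i < count A (iota 0 r)) = A i.
Proof.
elim: r => // r IH down i lt_ir.
have downr k l : k <= l -> l < r -> A l -> A k.
  by move=> kl lr; apply: down => //; lia.
rewrite -[r.+1]addn1 iotaD count_cat /= add0n addn0.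
case Ar: (A r).
  have -> : count A (iota 0 r) = r.
    rewrite -[RHS](size_iota 0 r); apply/eqP; rewrite -all_count.
    by apply/allP => k; rewrite mem_iota => kr; apply: down Ar; lia.
  by rewrite (down _ _ _ _ Ar) //; lia.
rewrite addn0; case: (ltnP i r) => [lt|le]; first exact: IH.
have -> : i = r by lia.
rewrite Ar; apply/negbTE; rewrite -leqNgt.
by rewrite (leq_trans (count_size _ _))// size_iota.
Qed.

Lemma frobenius_unique gamma delta lam mu :
  is_frobenius gamma delta lam -> is_frobenius gamma delta mu -> lam = mu.
Proof.
have diag nu : is_frobenius gamma delta nu ->
    forall i, 1 <= i -> i <= part nu i <-> i <= size gamma.
  move=> [dec card _] i i1.
  have [||H1 H2] := @card_eq_initial _ _ _ _ card i i1.
  - move=> k j /= k1 kj [j1 jP]; split=> //.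
    apply: (leq_trans kj (leq_trans jP _)).
    by apply: (is_partitionP nu dec k.-1 j.-1); lia.
  - by move=> j [].
  - by split=> [H|H]; [apply: H1|have [] := H2 H].
move=> Flam Fmu; apply/fsfunP => t.
have := diag _ Flam t.+1 isT; have := diag _ Fmu t.+1 isT.
have [dl _ Pl] := Flam; have [dm _ Pm] := Fmu.
rewrite /part /= in Pl Pm *.
case: (ltnP t (size gamma)) => [lt|ge] _ _.
  have [/= ? _] := Pl t.+1 lt; have [/= ? _] := Pm t.+1 lt; lia.
have small nu : is_frobenius gamma delta nu -> nu t <= size gamma.
  move=> Fnu; have [dn _ _] := Fnu.
  apply: leq_trans (is_partitionP _ dn _ _ ge) _.
  have [H _] := diag _ Fnu (size gamma).+1 isT; rewrite /part /= in H.
  by rewrite leqNgt; apply/negP => /H; lia.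
have le nu xi : is_frobenius gamma delta nu -> is_frobenius gamma delta xi ->
    nu t <= xi t.
  move=> Fnu Fxi; have := small _ Fnu.
  have [dn _ Pn] := Fnu; have [dx _ Px] := Fxi.
  case nut: (nu t) => [//|j] lt_j.
  rewrite leq_part_conj//.
  have [_ nc] := Pn j.+1 lt_j; have [_ xc] := Px j.+1 lt_j.
  have -> : conj_part xi j.+1 = conj_part nu j.+1 by lia.
  by rewrite -leq_part_conj// nut.
by apply/eqP; rewrite eqn_leq !le.
Qed.

Lemma frobeniusP gamma delta :
  sorted gtn gamma -> sorted gtn delta -> size gamma = size delta ->
  is_frobenius gamma delta (frobenius gamma delta).
Proof.
move=> sg sd sz; apply: xgetPex.
set r := size gamma.
have srt s i j : sorted gtn s -> i <= j -> j < size s ->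
    nth 0 s j + (j - i) <= nth 0 s i.
  move=> ss; elim: j => [|j IH] ij js.
    by move: ij; rewrite leqn0 => /eqP ->; rewrite addn0.
  move: ij; rewrite leq_eqVlt => /predU1P[->|]; first by lia.
  rewrite ltnS => ij; have := IH ij (ltnW js).
  have /= := elimT (sortedP 0) ss j js; lia.
pose e k := nth 0 delta k + k.
pose c t := count (fun k => t <= e k) (iota 0 r).
have cE t i : i < r -> (i < c t) = (t <= e i).
  apply: count_initial => k l kl lr; have := srt delta k l sd kl.
  by rewrite -sz => /(_ lr); rewrite /e; lia.
have c_le t : c t <= r by rewrite (leq_trans (count_size _ _))// size_iota.
have c_dec t u : t <= u -> c u <= c t.
  by move=> tu; apply: sub_count => k /=; apply: leq_trans.
pose f t := if t < r then nth 0 gamma t + t.+1 else c t.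
pose N := r + (e 0).+1.
pose lam : natseq := [fsfun t in [fset k in iota 0 N]%fset => f t].
have lamE t : lam t = f t.
  rewrite fsfunE !inE mem_iota /=; case: ltnP => // le_Nt.
  rewrite /f; case: ltnP => [|rt]; first by rewrite /N in le_Nt; lia.
  apply/esym/eqP; rewrite -leqn0 leqNgt; apply/negP.
  case: (posnP r) => [r0|r0]; first by have := c_le t; lia.
  by rewrite cE// ; rewrite /N in le_Nt; lia.
have dec : is_partition lam.
  case=> // t _; rewrite /part /= !lamE /f.
  case: (ltnP t.+1 r) => t1r.
    by rewrite (ltnW t1r); have := srt gamma t t.+1 sg (leqnSn t) t1r; lia.
  case: (ltnP t r) => tr; first by have := c_le t.+1; lia.
  exact: c_dec.
have lam_conj i : i < r -> conj_part lam i.+1 = (e i).+1.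
  move=> ir.
  have H t : (t < conj_part lam i.+1) = (t < (e i).+1).
    rewrite -leq_part_conj// lamE /f ltnS; case: (ltnP t r) => tr; last by rewrite cE.
    have := srt delta i r.-1 sd; have := srt gamma t r.-1 sg.
    by rewrite -sz -/r /e; lia.
  by have := H (e i).+1; have := H (e i); lia.
exists lam; split=> //.
  have -> : [set i | 1 <= i /\ i <= part lam i] = [set i | 1 <= i <= r].
    apply/seteqP; split=> -[|t] //=; first by case.
      by rewrite /part /= lamE /f => -[_]; have := c_le t; case: ifP; lia.
    by rewrite /part /= lamE /f => tr; rewrite tr; split=> //; lia.
  exact: card_iota1.
case=> // i /= ir; rewrite lam_conj// /part /= lamE /f ir /e.
by split; lia.
Qed.

Lemma differ_at_unique lam mu p q :
  differ_at lam mu p -> differ_at lam mu q -> p = q.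
Proof.
move=> [[E np]|[E np]] [[E' nq]|[E' nq]].
- by have : Young lam p by [rewrite E; right]; rewrite E' => -[/np|].
- by case: nq; rewrite E E'; left; right.
- by case: nq; rewrite E E'; left; right.
- by have : Young mu p by [rewrite E; right]; rewrite E' => -[/np|].
Qed.

Lemma YoungE lam i j : is_partition lam ->
  Young lam (i.+1, j.+1) <-> j < lam i.
Proof.
move=> dec; rewrite /Young /part /=; split=> [[]//|lt]; split=> //=.
have := leq_part_conj _ dec 1 i isT.
rewrite /conj_part /part_length.
have -> : [fset k in finsupp lam | 0 < lam k]%fset = finsupp lam.
  by apply/fsetP => k; rewrite !inE mem_finsupp lt0n andbb.
by move=> <-; lia.
Qed.

Lemma OT_bound lam l eta k : OT lam l eta -> k <= l ->
  forall i j, j < eta_at eta k i -> i + j < k.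
Proof.
move=> [part0 eta0 _ sq]; elim: k => [|k IH] kl i j.
  by rewrite eta0 fsfunE.
have dk := part0 k (ltnW kl); have dk1 := part0 k.+1 kl.
have [p /= [[E np]|[E np]]] := sq k.+1 kl.
  rewrite -YoungE// => Y.
  have : Young (eta_at eta k) (i.+1, j.+1) by rewrite E; left.
  by rewrite YoungE// => /(IH (ltnW kl)); lia.
rewrite -YoungE// => Y; have := Y; rewrite E => -[|pE].
  by rewrite YoungE// => /(IH (ltnW kl)); lia.
have big u v : u <= i -> v <= j -> (u, v) <> (i, j) -> u + v < k.
  move=> ui vj uv; apply: (IH (ltnW kl)); rewrite -YoungE//.
  have : Young (eta_at eta k.+1) (u.+1, v.+1).
    rewrite YoungE//; apply: leq_ltn_trans vj _.
    by apply: leq_trans (is_partitionP _ dk1 _ _ ui); rewrite -YoungE.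
  rewrite E => -[//|]; rewrite -pE => -[ui' vj'].
  by case: uv; rewrite ui' vj'.
case: i Y pE big => [|i] Y pE big.
  case: j Y pE big => [|j] Y pE big; first by lia.
  by have := big 0 j (leqnn _) (leqnSn _); rewrite add0n => /(_ _)[]; [case; lia|lia].
have : (i, j) <> (i.+1, j) by case; lia.
by move/(big i j (leqnSn _) (leqnn _)); lia.
Qed.

(* Sums \big[addn/0]_(eta \in OT lam l) are therefore genuine finite sums. *)
Lemma OT_finite lam l : finite_set (OT lam l).
Proof.
pose code (eta : l.+1.-tuple natseq) : {ffun 'I_l.+1 * 'I_l -> 'I_l.+1} :=
  [ffun ki : 'I_l.+1 * 'I_l => inord (eta_at eta ki.1 ki.2)].
have inj : {in OT lam l &, injective code}.
  move=> eta xi; rewrite !inE => Oe Ox /ffunP codeE.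
  apply/val_inj/(@eq_from_nth _ empty_part); rewrite ?size_tuple// => k kl.
  apply/fsfunP => i; rewrite -/(eta_at eta k) -/(eta_at xi k).
  have bd z : OT lam l z -> eta_at z k i <= l /\ (l <= i -> eta_at z k i = 0).
    move=> Oz; case zk: (eta_at z k i) => [|n]; first by [].
    by have := OT_bound _ _ _ k Oz kl i n; rewrite zk; lia.
  have [e1 e2] := bd _ Oe; have [x1 x2] := bd _ Ox.
  case: (leqP l i) => [li|il]; first by rewrite e2// x2.
  have := congr1 val (codeE (Ordinal kl, Ordinal il)).
  by rewrite !ffunE /= !inordK.
rewrite -(eq_finite_set (inj_card_eq inj)); exact: finite_finset.
Qed.

(* Main.v *)
Require Import Defs.
From mathcomp Require Import all_boot all_order all_algebra finmap.
From mathcomp Require Import all_classical zify.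

(* A tuple of osculating paths is recorded by which edges of the grid it uses:
   h i j is the edge to the right of (i, j), v i j the edge below it.  Reading
   the edges along a monotone profile from the south-west to the north-east,
   with label 1 - h on vertical steps and v on horizontal steps, a point of
   content c either keeps the labels in positions c - 1 and c, or, exactly when
   it is a vacancy or an osculation, exchanges two different labels.  The labels
   of a profile are the Maya diagram of a partition, and such an exchange adds
   or removes a square of content c.  The profile of the north-west boundary is
   the empty partition and that of the south-east boundary is
   lambda_(a,b,alpha,beta), so listing the points of Z(P) along a linear
   extension of [a] x [b] gives an oscillating tableau.

   The linear extension processes the min(a,b) hooks with corners
   (a - k, b - k), k decreasing, each of them in the given (b - a)-order.  Hence
   a set Z with tableau eta amounts to weakly increasing hook numbers t_1, ...,
   t_l in [min(a,b)] with t_k < t_(k+1) wherever eta has no ascent, and there are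
   binomial(min(a,b) + ascents, l) of these.

   Conversely the paths are recovered from the used edges diagonal by diagonal:
   the k-th path uses the k-th edge from the north-west. *)

Import Order.TTheory GRing.Theory Num.Theory.

(** * Words of contents *)

Definition swap (c : int) (M : int -> bool) (p : int) : bool :=
  if p == (c - 1)%R then M c else if p == c then M (c - 1)%R else M p.

Fixpoint run (M : int -> bool) (w : seq int) : int -> bool :=
  if w is c :: w' then run (swap c M) w' else M.

Fixpoint admissible (M : int -> bool) (w : seq int) : bool :=
  if w is c :: w' then (M (c - 1)%R != M c) && admissible (swap c M) w' else true.

Definition vacuum (p : int) : bool := (p < 0)%R.

Lemma run_cat M w w' : run M (w ++ w') = run (run M w) w'.
Proof. by elim: w M => //= c w IH M. Qed.

Lemma admissible_cat M w w' :
  admissible M (w ++ w') = admissible M w && admissible (run M w) w'.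
Proof. by elim: w M => //= c w IH M; rewrite IH andbA. Qed.

(** Only an exchange at [z - 1] can bring a [true] into the positions from [z - 1] on: exchanges at
    smaller contents do not reach them, and an earlier one at a larger content would exchange two
    [false] labels. *)
Lemma admissible_right M (z : int) w w' :
  (forall p : int, (z - 1 <= p)%R -> M p = false) ->
  admissible M (w ++ z :: w') -> (z - 1)%R \in w.
Proof.
elim: w M => [|c w IH] M M0 /=; first by rewrite !M0//; lia.
case/andP=> ne adm; rewrite inE; apply/orP.
have [->|zc] := eqVneq (z - 1)%R c; [by left|right].
case: (leP z c) => zc'; first by rewrite !M0 // in ne; lia.
by apply: IH adm => p zp; rewrite /swap !ifF ?M0 //; lia.
Qed.

Lemma admissible_left M (z : int) w w' :
  (forall p : int, (p <= z)%R -> M p = true) ->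
  admissible M (w ++ z :: w') -> (z + 1)%R \in w.
Proof.
elim: w M => [|c w IH] M M1 /=; first by rewrite !M1//; lia.
case/andP=> ne adm; rewrite inE; apply/orP.
have [->|zc] := eqVneq (z + 1)%R c; [by left|right].
case: (leP c z) => zc'; first by rewrite !M1 // in ne; lia.
by apply: IH adm => p zp; rewrite /swap !ifF ?M1 //; lia.
Qed.

(** * Counting the ways to distribute a word over ordered layers *)

Section Layers.
Variable prec : rel int.

Definition layer_lt (x y : nat * int) : bool :=
  (x.1 < y.1) || (x.1 == y.1) && prec x.2 y.2.

Fixpoint word_ascents (c0 : int) (w : seq int) : nat :=
  if w is c :: w' then prec c0 c + word_ascents c w' else 0.

Lemma word_ascents_size c0 w : word_ascents c0 w <= size w.
Proof. by elim: w c0 => //= c w IH c0; have := IH c; case: prec => /=; lia. Qed.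

Lemma layer_lt_irr : irreflexive prec -> irreflexive layer_lt.
Proof. by move=> irr x; rewrite /layer_lt ltnn irr andbF. Qed.

Lemma layer_lt_trans : transitive prec -> transitive layer_lt.
Proof.
move=> tr y x z; rewrite /layer_lt => /orP[xy|/andP[/eqP xy pxy]] /orP[yz|/andP[/eqP yz pyz]].
- by rewrite (ltn_trans xy yz).
- by rewrite -yz xy.
- by rewrite xy yz.
- by rewrite xy yz eqxx (tr _ _ _ pxy pyz) orbT.
Qed.

(** The boundary term of the telescoping sum is ['C(A, l.+1)], which vanishes because [A <= l]. *)
Lemma hockey_stick (A l m x : nat) : A <= l ->
  \sum_(y < m | x <= y) 'C(m - y.+1 + A, l) = 'C(m - x + A, l.+1).
Proof.
move=> Al; rewrite -(big_geq_mkord _ _ predT (fun y => 'C(m - y.+1 + A, l))).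
case: (leqP m x) => [mx|xm].
  by rewrite big_geq// bin_small//; lia.
have -> : m = x + (m - x) by lia.
move: (m - x) => d {xm}; elim: d x => [|d IH] x.
  by rewrite big_geq ?bin_small//; lia.
rewrite big_ltn; last by lia.
rewrite -addSnnS IH.
have -> : x.+1 + d - x.+1 = d by lia.
have -> : x.+1 + d - x = d.+1 by lia.
by rewrite addSn binS [RHS]addnC.
Qed.

Lemma card_cons_tuples (m l : nat) (Q : pred (seq 'I_m)) :
  #|[set t : l.+1.-tuple 'I_m | Q t]| =
  \sum_(x < m) #|[set t : l.-tuple 'I_m | Q (x :: t)]|.
Proof.
rewrite -sum1_card (partition_big (fun t : l.+1.-tuple 'I_m => thead t) predT)//=.
apply: eq_bigr => x _; rewrite -sum1_card.
rewrite (reindex_onto (fun t : l.-tuple 'I_m => [tuple of x :: t])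
  (fun t => [tuple of behead t])); last first.
  move=> t /andP[_ /eqP <-]; apply/val_inj => /=; by case/tupleP: t => y t /=; rewrite theadE.
apply: eq_bigl => t; rewrite !inE theadE eqxx andbT /=.
rewrite (_ : _ == _ = true) ?andbT//; apply/eqP/val_inj => //.
Qed.

(** The next letter may stay in layer [x0] at an ascent and must move to a later layer otherwise.
    Each ascent thus widens the range of choices by one, and [hockey_stick] sums over the layer
    chosen. *)
Lemma card_layer_path (m x0 : nat) (c0 : int) (w : seq int) : x0 < m ->
  #|[set t : (size w).-tuple 'I_m | path layer_lt (x0, c0) (zip (map val t) w)]|
  = 'C(m - x0.+1 + word_ascents c0 w, size w).
Proof.
elim: w x0 c0 => [|c w IH] x0 c0 x0m.
  rewrite bin0; apply/eqP/cards1P; exists [tuple]; apply/setP => t.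
  by rewrite !inE (tuple0 t) eqxx.
rewrite (@card_cons_tuples _ _ (fun t => path layer_lt (x0, c0) (zip (map val t) (c :: w)))).
(* [x0 + ~~ prec c0 c] is the first layer open to the next letter. *)
rewrite (bigID (fun x : 'I_m => x0 + ~~ prec c0 c <= x))/= [X in _ + X]big1 ?addn0; last first.
  move=> x lt; apply: eq_card0 => t; rewrite !inE /layer_lt /=.
  by case: (prec c0 c) lt => /=; lia.
under eq_bigr => x xx0.
  rewrite (_ : #|_| = 'C(m - x.+1 + word_ascents c w, size w)); last first.
    rewrite -IH//; apply: eq_card => t; rewrite !inE /= andb_idl// => _.
    by rewrite /layer_lt /=; case: (prec c0 c) xx0 => /=; lia.
  over.
rewrite hockey_stick ?word_ascents_size//; congr 'C(_, _).
by have := word_ascents_size c w; case: (prec c0 c) => /=; lia.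
Qed.

Lemma card_layer_sorted (m : nat) (w : seq int) :
  #|[set t : (size w).-tuple 'I_m | sorted layer_lt (zip (map val t) w)]|
  = 'C(m + word_ascents (head 0%R w) (behead w), size w).
Proof.
case: w => [|c w].
  rewrite bin0; apply/eqP/cards1P; exists [tuple]; apply/setP => t.
  by rewrite !inE (tuple0 t) eqxx.
rewrite (@card_cons_tuples _ _ (fun t => sorted layer_lt (zip (map val t) (c :: w)))) /=.
under eq_bigr => x _ do rewrite card_layer_path//.
by rewrite (hockey_stick _ _ m 0) ?word_ascents_size// subn0.
Qed.
End Layers.

(** * Labels of profiles *)

(** A row is scanned from its left end, where no edge enters, with the edges above it given as
    [top]. Nesting this in a recursion on the rows keeps both recursions structural. *)
Fixpoint scan_right (z top : nat -> bool) (j : nat) : bool :=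
  if j is j'.+1 then if z j then scan_right z top j' else ~~ top j else false.

Definition scan_below (z top : nat -> bool) (j : nat) : bool :=
  if j is j'.+1 then if z j then top j else ~~ scan_right z top j' else false.

(* The configuration is determined by the set Z of vacancies and osculations:
   at a point of Z opposite edges agree, elsewhere the lower edge complements the
   left one and the right edge complements the upper one. *)
Fixpoint edge_below (Z : nat -> nat -> bool) (i : nat) : nat -> bool :=
  if i is i'.+1 then scan_below (Z i) (edge_below Z i') else fun _ => false.

Definition edge_right (Z : nat -> nat -> bool) (i j : nat) : bool :=
  if i is i'.+1 then scan_right (Z i) (edge_below Z i') j else false.

Definition content (p : nat * nat) : int := (p.2%:Z - p.1%:Z)%R.

Definition order_ideal (D : seq (nat * nat)) : Prop :=
  forall i j i' j', (i.+1, j.+1) \in D -> i' <= i -> j' <= j ->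
    (i'.+1, j'.+1) \in D.

Definition zword (Z : nat -> nat -> bool) (D : seq (nat * nat)) : seq int :=
  [seq content p | p <- D & Z p.1 p.2].

Section Profile.
Variables (Z : nat -> nat -> bool).
Let h := edge_right Z.
Let v := edge_below Z.

Lemma edge_rightS i j :
  h i.+1 j.+1 = if Z i.+1 j.+1 then h i.+1 j else ~~ v i j.+1.
Proof. by []. Qed.

Lemma edge_belowS i j :
  v i.+1 j.+1 = if Z i.+1 j.+1 then v i j.+1 else ~~ h i.+1 j.
Proof. by []. Qed.

Lemma edge_right0 i : h i 0 = false. Proof. by case: i. Qed.

(* The quantification includes the points outside the rectangle: these are never
   processed, and they read off the labels of the boundary in the end. *)
Definition profile (D : seq (nat * nat)) (M : int -> bool) : Prop :=
  forall i j, (i.+1, j.+1) \notin D ->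
    (((i.+1, j) \in D) || (j == 0) -> M (j%:Z - i.+1%:Z)%R = ~~ h i.+1 j) /\
    (((i, j.+1) \in D) || (i == 0) -> M (j%:Z - i%:Z)%R = v i j.+1).

(** A point that can be added to the ideal sits in a corner of the profile: its left and upper
    neighbours are processed or have a coordinate 0, so the edges to them lie on the profile. *)
Lemma profile_pred D i0 j0 p M : p = (i0.+1, j0.+1) ->
  p \notin D -> order_ideal (rcons D p) -> profile D M ->
  M (content p - 1)%R = ~~ h i0.+1 j0 /\ M (content p) = v i0 j0.+1.
Proof.
move=> pE pD ideal prof.
have pin : (i0.+1, j0.+1) \in rcons D p by rewrite -pE mem_rcons mem_head.
have [] := prof i0 j0; first by rewrite -pE.
have -> : (j0%:Z - i0.+1%:Z = content p - 1)%R by rewrite pE /content /=; clear; lia.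
have -> : (j0%:Z - i0%:Z = content p)%R by rewrite pE /content /=; clear; lia.
move=> Hh Hv; split; [apply: Hh => {Hv}|apply: Hv => {Hh}].
  case: j0 pE pin => [|j0] pE pin; first by rewrite orbT.
  have := ideal i0 j0.+1 i0 j0 pin (leqnn _) (leqnSn _).
  by rewrite mem_rcons inE pE => /predU1P[[]|->//]; clear; lia.
case: i0 pE pin => [|i0] pE pin; first by rewrite orbT.
have := ideal i0.+1 j0 i0 j0 pin (leqnSn _) (leqnn _).
by rewrite mem_rcons inE pE => /predU1P[[]|->//]; clear; lia.
Qed.

(** Passing [p] flips the corner: position [content p - 1] now reads the edge below [p], position
    [content p] the edge to its right. On Z opposite edges agree, so the two labels change places;
    elsewhere the complements in the recursion leave both labels as they were. *)
Lemma profile_step D i0 j0 p M : p = (i0.+1, j0.+1) ->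
  p \notin D -> order_ideal D -> order_ideal (rcons D p) -> profile D M ->
  profile (rcons D p) (if Z p.1 p.2 then swap (content p) M else M).
Proof.
move=> pE pD idD idD' prof i j.
have [Mh Mv] := profile_pred _ _ _ _ _ pE pD idD' prof.
have pin : (i0.+1, j0.+1) \in rcons D p by rewrite -pE mem_rcons mem_head.
rewrite mem_rcons in_cons negb_or => /andP[ijp ijD].
(* By [nle] and [nge] the other edges of the profile avoid both positions: one with such a content
   would put an unprocessed point north-west of [p] or a processed one south-east of it. *)
have nle : ~ (i <= i0 /\ j <= j0).
  move=> [ii jj]; have := idD' _ _ _ _ pin ii jj.
  by rewrite mem_rcons in_cons (negbTE ijp) (negbTE ijD).
have nge k l : (k.+1, l.+1) \in D -> ~ (i0 <= k /\ j0 <= l).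
  by move=> kl [ik jl]; rewrite pE (idD _ _ _ _ kl ik jl) in pD.
have [Ih Iv] := prof _ _ ijD.
have cE : content p = (j0%:Z - i0%:Z)%R by rewrite pE /content /=; clear; lia.
have stay q : q <> content p -> q <> (content p - 1)%R ->
    (if Z p.1 p.2 then swap (content p) M else M) q = M q.
  by move=> /eqP/negbTE q1 /eqP/negbTE q2; case: ifP => // _; rewrite /swap q2 q1.
split.
  rewrite mem_rcons in_cons -orbA; have [ijE _|ne /= jD] := eqVneq (i.+1, j) p.
    move: ijE; rewrite pE => -[-> ->].
    have -> : (j0.+1%:Z - i0.+1%:Z = content p)%R by rewrite cE; clear; lia.
    rewrite edge_rightS pE /=; case: ifP => _; last by rewrite -pE Mv negbK.
    by rewrite -pE /swap eqxx ifF ?Mh//; clear; lia.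
  have nge' : ~ (i0 <= i /\ j0 < j).
    case: j jD nge {ijp ijD nle Ih Iv ne} => [_ _|j]; first by clear; lia.
    by rewrite orbF => /[swap] H /H.
  by rewrite -Ih // stay// cE; clear -nle nge'; lia.
rewrite mem_rcons in_cons -orbA; have [ijE _|ne /= iD] := eqVneq (i, j.+1) p.
  move: ijE; rewrite pE => -[-> ->].
  have -> : (j0%:Z - i0.+1%:Z = content p - 1)%R by rewrite cE; clear; lia.
  rewrite edge_belowS pE /=; case: ifP => _; last by rewrite -pE Mh.
  by rewrite -pE /swap eqxx Mv.
have nge' : ~ (i0 < i /\ j0 <= j).
  case: i iD nge {ijp ijD nle Ih Iv ne} => [_ _|i]; first by clear; lia.
  by rewrite orbF => /[swap] H /H.
by rewrite -Iv // stay// cE; clear -nle nge'; lia.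
Qed.

Lemma zword_rcons D p :
  zword Z (rcons D p) = zword Z D ++ if Z p.1 p.2 then [:: content p] else [::].
Proof. by rewrite /zword filter_rcons; case: ifP; rewrite ?cats0// map_rcons cats1. Qed.

(** The labels met at a point are [~~ h] and [v], so they differ exactly when its left and upper
    edges agree. As opposite edges agree on Z, admissibility says that all four edges agree
    there. *)
Lemma run_profile L : uniq L -> all (fun p => (0 < p.1) && (0 < p.2)) L ->
  (forall L1 L2, L = L1 ++ L2 -> order_ideal L1) ->
  profile L (run vacuum (zword Z L)) /\
  admissible vacuum (zword Z L) =
    all (fun p => Z p.1 p.2 ==> (h p.1 p.2.-1 == v p.1.-1 p.2)) L.
Proof.
elim/last_ind: L => [|L p IH].
  move=> _ _ _; split=> // i j _ /=; by split=> /eqP ->; rewrite /vacuum /h /v /=; clear; lia.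
rewrite rcons_uniq all_rcons -cats1 => /andP[pL uL] /andP[/andP[p1 p2] pos] ideal.
have [|prof adm] := IH uL pos; first by move=> L1 L2 E; apply: (ideal _ (L2 ++ [:: p])); rewrite E catA.
case: p pL p1 p2 ideal => -[//|i] [//|j] /= pL _ _ ideal.
have idL := ideal L [:: _] erefl.
have idL' : order_ideal (rcons L (i.+1, j.+1)) by apply: (ideal _ [::]); rewrite cats0 cats1.
have [Mh Mv] := profile_pred _ _ _ _ _ erefl pL idL' prof.
rewrite cats1 zword_rcons run_cat; split.
  by have := profile_step _ _ _ _ _ erefl pL idL idL' prof; case: ifP.
rewrite all_rcons admissible_cat adm /= andbC; congr (_ && _).
case: ifP => //= _; rewrite andbT Mh Mv.
by rewrite -[scan_right _ _ _]/(h i.+1 j); case: (h i.+1 j); case: (v i j.+1).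
Qed.

End Profile.

(** * The hook order *)

Section Hooks.
Variables (a b : nat) (a_gt0 : 0 < a) (b_gt0 : 0 < b).
Variables (prec : rel int) (prec_q : q_order (b%:Z - a%:Z)%R prec).

Notation cell := ('I_a * 'I_b)%type.

Definition cell_point (p : cell) : nat * nat := (p.1.+1, p.2.+1).

(** [minn (a - p.1) (b - p.2)] is the k of the hook with corner (a - k, b - k); the subtraction
    gives number 0 to the hook processed first. *)
Definition layer (p : nat * nat) : nat :=
  (minn a b).-1 - minn (a - p.1) (b - p.2).

Definition hook_pos (p : cell) : nat * int := (layer (cell_point p), content (cell_point p)).

Definition hook_lt : rel cell :=
  [rel p q | layer_lt prec (hook_pos p) (hook_pos q)].

Lemma cell_point_inj : injective cell_point.
Proof. by case=> [i j] [i' j'] [/val_inj -> /val_inj ->]. Qed.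

Lemma hook_pos_inj : injective hook_pos.
Proof.
case=> [[i ia] [j jb]] [[i' ia'] [j' jb']] [].
rewrite /layer /content /= => H1 H2; congr (_, _); apply/val_inj => /=; lia.
Qed.

Lemma layer_bound p : layer p < minn a b.
Proof. rewrite /layer; lia. Qed.

Let prec_irr : irreflexive prec. Proof. by case: prec_q => -[]. Qed.
Let prec_trans : transitive prec. Proof. by case: prec_q => -[]. Qed.
Let prec_total z z' : z != z' -> prec z z' || prec z' z.
Proof. by case: prec_q => -[_ _ H] _; apply: H. Qed.

Lemma hook_lt_irr : irreflexive hook_lt.
Proof. by move=> p; apply: layer_lt_irr. Qed.

Lemma hook_lt_trans : transitive hook_lt.
Proof. by move=> p q r; apply: layer_lt_trans. Qed.

Lemma hook_lt_total p q : p != q -> hook_lt p q || hook_lt q p.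
Proof.
move=> pq; rewrite /hook_lt /= /layer_lt.
case: ltngtP => //= tpq; apply: prec_total; apply: contra_neq pq => cpq.
by apply: hook_pos_inj; congr (_, _).
Qed.

(** Moving down or right never lowers the layer. Comparable points of one hook lie on the same arm:
    contents rise to b - a along the row and fall to b - a down the column, which are the two
    monotonicities of a (b - a)-order. *)
Lemma hook_lt_le (p q : cell) : p.1 <= q.1 -> p.2 <= q.2 -> p != q -> hook_lt p q.
Proof.
case: p q => [[i ia] [j jb]] [[i' ia'] [j' jb']] /= ii jj ne.
have : (i != i') || (j != j').
  rewrite -negb_and; apply: contra ne => /andP[/eqP ii' /eqP jj'].
  by apply/eqP; congr (_, _); apply/val_inj.
case: prec_q => _ pq neq.
have := pq (content (i.+1, j.+1)) (content (i'.+1, j'.+1)).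
rewrite /hook_lt /= /layer_lt /hook_pos /layer /content /=.
case: (prec _ _) => H; first by clear -neq ii jj ia' jb'; lia.
suff: ~ ~~ ((minn a b).-1 - minn (a - i.+1) (b - j.+1) <
  (minn a b).-1 - minn (a - i'.+1) (b - j'.+1)) by case: (_ < _) => // /(_ isT).
by move=> nlt; suff: false by []; apply: H; clear -nlt neq ii jj ia' jb'; lia.
Qed.

(** Adding equality makes the strict order total in the sense of [sort_sorted]. *)
Definition grid : seq cell := sort (fun p q => (p == q) || hook_lt p q) (enum {: cell}).

Lemma mem_grid p : p \in grid.
Proof. by rewrite mem_sort mem_enum. Qed.

Lemma grid_uniq : uniq grid.
Proof. by rewrite sort_uniq enum_uniq. Qed.

Lemma grid_sorted : sorted hook_lt grid.
Proof.
have tr : transitive (fun p q => (p == q) || hook_lt p q).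
  move=> q p r /predU1P[-> //|pq] /predU1P[<-|qr]; apply/predU1P; right=> //.
  exact: hook_lt_trans pq qr.
have tot : total (fun p q => (p == q) || hook_lt p q).
  move=> p q; have [//|ne] := eqVneq p q.
  exact: hook_lt_total.
have := sort_sorted tot (enum {: cell}); rewrite -/grid !sorted_pairwise//; last exact: hook_lt_trans.
have := grid_uniq; rewrite uniq_pairwise => ne le.
have := conj ne le => /andP; rewrite -pairwise_relI; apply: sub_pairwise => p q /=.
by case/andP=> /negPf ->.
Qed.

Lemma grid_ideal L1 L2 : [seq cell_point p | p <- grid] = L1 ++ L2 -> order_ideal L1.
Proof.
move=> E i j i' j' q1 ii jj.
have : (i.+1, j.+1) \in [seq cell_point p | p <- grid] by rewrite E mem_cat q1.
case/mapP=> -[[i0 ia] [j0 jb]] _ [/= iE jE]; rewrite {}iE {}jE in q1 ii jj.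
have ia' : i' < a by lia.
have jb' : j' < b by lia.
pose q' : cell := (Ordinal ia', Ordinal jb'); pose q : cell := (Ordinal ia, Ordinal jb).
have [Eq|ne] := eqVneq (cell_point q') (cell_point q).
  by rewrite -[_ \in _]/(cell_point q' \in L1) Eq.
have lt : hook_lt q' q by apply: hook_lt_le => //; apply: contra_neq ne => ->.
have := mem_grid q' => /(map_f cell_point); rewrite E mem_cat => /orP[//|q2].
have := grid_sorted; rewrite sorted_pairwise; last exact: hook_lt_trans.
have E' : grid = take (size L1) grid ++ drop (size L1) grid by rewrite cat_take_drop.
have E1 : L1 = map cell_point (take (size L1) grid) by rewrite map_take E take_size_cat.
have E2 : L2 = map cell_point (drop (size L1) grid) by rewrite map_drop E drop_size_cat.
rewrite E' pairwise_cat => /andP[/allrelP H _].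
have /(H q q') : q \in take (size L1) grid.
  by rewrite -(mem_map cell_point_inj) -E1.
rewrite -(mem_map cell_point_inj) -E2 => /(_ q2) lt'.
by have := hook_lt_trans _ _ _ lt lt'; rewrite hook_lt_irr.
Qed.

Definition in_cells (A : {set cell}) (i j : nat) : bool := (i, j) \in [seq cell_point p | p in A].

Lemma in_cellsE A p : in_cells A (cell_point p).1 (cell_point p).2 = (p \in A).
Proof. by rewrite /in_cells fintype.mem_image //; apply: cell_point_inj. Qed.

Definition cells (A : {set cell}) : seq cell := [seq p <- grid | p \in A].

Definition cell_word (A : {set cell}) : seq int := [seq content (cell_point p) | p <- cells A].

Lemma cell_wordE A : cell_word A = zword (in_cells A) [seq cell_point p | p <- grid].
Proof.
rewrite /cell_word /zword filter_map -map_comp; congr map.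
by apply: eq_filter => p /=; rewrite in_cellsE.
Qed.

Lemma size_cell_word A : size (cell_word A) = #|A|.
Proof.
rewrite size_map /cells cardE; apply/perm_size/uniq_perm.
- by rewrite filter_uniq ?grid_uniq.
- exact: enum_uniq.
- by move=> p; rewrite mem_filter mem_grid mem_enum andbT.
Qed.

(** Labels of the south-east boundary, read from the south-west: the side below the rectangle, the
    bottom edges of columns 1 to b, the right edges of rows a down to 1, the side beyond the
    rectangle. On right edges the label is 1 - h, hence [\notin]. *)
Definition profile_target (alpha beta : {fset nat}) (p : int) : bool :=
  if (p < - a%:Z)%R then true
  else if (p < b%:Z - a%:Z)%R then (absz (p + a%:Z)%R).+1 \in beta
  else if (p < b%:Z)%R then absz (b%:Z - p)%R \notin alpha else false.

Lemma cell_word_admissible A :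
  admissible vacuum (cell_word A) =
  [forall p in A, edge_right (in_cells A) p.1.+1 p.2 == edge_below (in_cells A) p.1 p.2.+1].
Proof.
have [|||_] := run_profile (in_cells A) [seq cell_point p | p <- grid].
- by rewrite map_inj_uniq ?grid_uniq//; apply: cell_point_inj.
- by apply/allP => _ /mapP[p _ ->].
- exact: grid_ideal.
rewrite cell_wordE => ->; rewrite all_map; apply/allP/forall_inP => H p.
  by rewrite -in_cellsE => pA; have := H p (mem_grid p); rewrite /= pA.
by move=> _; apply/implyP; rewrite /= in_cellsE => /H.
Qed.

Lemma cell_word_run A alpha beta :
  run vacuum (cell_word A) =1 profile_target alpha beta <->
  (forall j, j < b -> edge_below (in_cells A) a j.+1 = (j.+1 \in beta)) /\
  (forall i, i < a -> edge_right (in_cells A) i.+1 b = (i.+1 \in alpha)).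
Proof.
have [|||prof _] := run_profile (in_cells A) [seq cell_point p | p <- grid].
- by rewrite map_inj_uniq ?grid_uniq//; apply: cell_point_inj.
- by apply/allP => _ /mapP[p _ ->].
- exact: grid_ideal.
move: prof; rewrite -cell_wordE; set M := run _ _ => prof.
have mem i j : 0 < i -> 0 < j ->
    ((i, j) \in [seq cell_point p | p <- grid]) = (i <= a) && (j <= b).
  case: i j => // i [//|j] _ _.
  apply/mapP/andP => [[[[i0 ia] [j0 jb]] _ [-> ->]]//|[ia jb]].
  by exists (Ordinal ia, Ordinal jb); rewrite ?mem_grid.
have M1 p : (p < - a%:Z)%R -> M p = true.
  move=> pa; have [|] := prof (absz p).-1 0; first by rewrite mem//; clear -pa; lia.
  rewrite orbT edge_right0 => /(_ isT) + _.
  by have -> : (0%:Z - (absz p).-1.+1%:Z = p)%R by lia.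
have M2 j : j < b -> M (j%:Z - a%:Z)%R = edge_below (in_cells A) a j.+1.
  move=> jb; have [|_] := prof a j; first by rewrite mem//; clear; lia.
  by apply; rewrite mem// jb leqnn.
have M3 i : i < a -> M (b%:Z - i.+1%:Z)%R = ~~ edge_right (in_cells A) i.+1 b.
  move=> ia; have [|+ _] := prof i b; first by rewrite mem//; clear; lia.
  by apply; rewrite mem// ia leqnn.
have M4 p : (p >= b%:Z)%R -> M p = false.
  move=> pb; have [|_] := prof 0 (absz p); first by rewrite mem//; clear -pb a_gt0; lia.
  rewrite orbT /= => /(_ isT).
  by have -> : ((absz p)%:Z - 0 = p)%R by lia.
split=> [ME|[Hb Ha] p].
  split=> [j jb|i ia].
    rewrite -M2// ME /profile_target ifF ?ifT; try by clear -jb; lia.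
    by have -> : absz (j%:Z - a%:Z + a%:Z)%R = j by clear; lia.
  apply: negb_inj; rewrite -M3// ME /profile_target ifF; [rewrite ifF; [rewrite ifT|]|]; try by clear -ia b_gt0; lia.
  by have -> : absz (b%:Z - (b%:Z - i.+1%:Z))%R = i.+1 by clear; lia.
rewrite /profile_target; case: ifP => [/M1 //|p1].
case: ifP => p2.
  rewrite -Hb -?M2; [congr M; lia|lia|lia].
case: ifP => p3; last by apply: M4; lia.
have -> : absz (b%:Z - p)%R = (absz (b%:Z - p)%R).-1.+1 by lia.
rewrite -Ha -?M3; [congr M; lia|lia|lia].
Qed.

(* With q = b - a, a content z > max(0, q) can only be exchanged after z - 1 has
   been, and z precedes z - 1 in the q-order, so that z - 1 belongs to an earlier
   hook; similarly for z < min(0, q). *)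
Lemma layer_range s : sorted (layer_lt prec) s -> admissible vacuum (unzip2 s) ->
  forall x, x \in s ->
  (Num.min 0 (b%:Z - a%:Z) - x.1%:Z <= x.2 <= Num.max 0 (b%:Z - a%:Z) + x.1%:Z)%R.
Proof.
rewrite sorted_pairwise; last exact: layer_lt_trans.
case: prec_q => -[_ _ _] pq srt adm.
have asym c c' : prec c c' -> prec c' c -> False.
  by move=> cc /(prec_trans _ _ _ cc); rewrite prec_irr.
have before x z : x \in s -> (forall w w', w ++ x.2 :: w' = unzip2 s -> z \in w) ->
    prec x.2 z -> exists2 y, y \in s & y.2 = z /\ y.1 < x.1.
  move=> xs zw xz; case/splitPr: xs srt zw => s1 s2.
  rewrite pairwise_cat => /and3P[/allrelP lt _ _] zw.
  have /mapP[y ys yz] : z \in unzip2 s1 by apply: (zw _ (unzip2 s2)); rewrite /unzip2 map_cat.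
  exists y; first by rewrite mem_cat ys.
  split=> //; have := lt y x ys (mem_head _ _); rewrite /layer_lt => /orP[//|/andP[_]].
  by rewrite -yz => /asym /(_ xz).
have upS x : x \in s -> (Num.max 0 (b%:Z - a%:Z) < x.2)%R ->
    exists2 y, y \in s & y.2 = (x.2 - 1)%R /\ y.1 < x.1.
  move=> xs xd; apply: before => //; last by apply: pq; clear -xd; lia.
  move=> w w' E; move: adm; rewrite -E => /admissible_right; apply => p xp.
  by rewrite /vacuum; clear -xp xd; lia.
have downS x : x \in s -> (x.2 < Num.min 0 (b%:Z - a%:Z))%R ->
    exists2 y, y \in s & y.2 = (x.2 + 1)%R /\ y.1 < x.1.
  move=> xs xd; apply: before => //; last by apply: pq; clear -xd; lia.
  move=> w w' E; move: adm; rewrite -E => /admissible_left; apply => p xp.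
  by rewrite /vacuum; clear -xp xd; lia.
(* Each further unit of content requires one more strictly earlier hook. *)
have up d x : x \in s -> (Num.max 0 (b%:Z - a%:Z) + d%:Z < x.2)%R -> d < x.1.
  elim: d x => [|d IH] x xs xd.
    have [|y _ [_ yx]] := upS x xs; first by clear -xd; lia.
    by clear -yx; lia.
  have [|y ys [yz yx]] := upS x xs; first by clear -xd; lia.
  by apply: leq_ltn_trans yx; apply: IH => //; rewrite yz; clear -xd; lia.
have down d x : x \in s -> (x.2 < Num.min 0 (b%:Z - a%:Z) - d%:Z)%R -> d < x.1.
  elim: d x => [|d IH] x xs xd.
    have [|y _ [_ yx]] := downS x xs; first by clear -xd; lia.
    by clear -yx; lia.
  have [|y ys [yz yx]] := downS x xs; first by clear -xd; lia.
  by apply: leq_ltn_trans yx; apply: IH => //; rewrite yz; clear -xd; lia.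
move=> x xs; have := up x.1 x xs; have := down x.1 x xs; rewrite ltnn.
by clear; lia.
Qed.

(** The corner of every hook has content b - a; smaller contents lie on the horizontal arm, larger
    ones on the vertical arm. Counting from 0, the corner of hook [t] is in row [a - minn a b + t]
    and column [b - minn a b + t]. *)
Lemma hook_pos_onto (t : nat) (c : int) : t < minn a b ->
  (Num.min 0 (b%:Z - a%:Z) - t%:Z <= c <= Num.max 0 (b%:Z - a%:Z) + t%:Z)%R ->
  exists p, hook_pos p = (t, c).
Proof.
move=> tm cr; case: (leP c (b%:Z - a%:Z)%R) => cq.
  have ia : a - minn a b + t < a by clear -tm; lia.
  have jb : absz ((a - minn a b + t)%N%:Z + c)%R < b by clear -tm cr cq; lia.
  exists (Ordinal ia, Ordinal jb); rewrite /hook_pos /layer /content /=.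
  by congr (_, _); clear -tm cr cq; lia.
have ia : absz ((b - minn a b + t)%N%:Z - c)%R < a by clear -tm cr cq; lia.
have jb : b - minn a b + t < b by clear -tm; lia.
exists (Ordinal ia, Ordinal jb); rewrite /hook_pos /layer /content /=.
by congr (_, _); clear -tm cr cq; lia.
Qed.

Lemma cells_of_sorted (s : seq cell) : sorted hook_lt s -> cells [set p in s] = s.
Proof.
move=> ss; apply: (irr_sorted_eq hook_lt_trans hook_lt_irr) => //.
  by apply: sorted_filter grid_sorted; apply: hook_lt_trans.
by move=> p; rewrite mem_filter mem_grid inE andbT.
Qed.

(** Sets with word [w] correspond to sorted assignments of layers to its letters: by [layer_range]
    admissibility keeps each content within the reach of its layer, so every pair of a layer and a
    content is the position of a cell. *)
Lemma card_cell_word w : admissible vacuum w ->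
  #|[set A | cell_word A == w]| =
  'C(minn a b + word_ascents prec (head 0%R w) (behead w), size w).
Proof.
move=> adm; rewrite -card_layer_sorted.
pose o : cell := (Ordinal a_gt0, Ordinal b_gt0).
pose find (x : nat * int) : cell := odflt o [pick p | hook_pos p == x].
have findK p : find (hook_pos p) = p.
  rewrite /find; case: pickP => [q /eqP/hook_pos_inj //|/(_ p)]; by rewrite eqxx.
pose T := [set t : (size w).-tuple 'I_(minn a b) |
  sorted (layer_lt prec) (zip (map val t) w)].
pose s (t : (size w).-tuple 'I_(minn a b)) := map find (zip (map val t) w).
have sK t : t \in T -> map hook_pos (s t) = zip (map val t) w.
  rewrite inE => srt; rewrite -map_comp map_id_in// => -[x c] xs /=.
  have := layer_range _ srt; rewrite unzip2_zip ?size_map ?size_tuple// => /(_ adm _ xs) /= rng.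
  have xm : x < minn a b.
    have := map_f fst xs; rewrite -/(unzip1 _) unzip1_zip ?size_map ?size_tuple//.
    by case/mapP=> y _ /= ->.
  have [p pE] := hook_pos_onto _ _ xm rng; by rewrite -pE findK.
have cellsK t : t \in T -> cells [set p in s t] = s t.
  move=> tT; apply: cells_of_sorted.
  have := tT; rewrite inE -(sK _ tT) sorted_map; apply: sub_sorted => p q //.
rewrite -(@card_in_imset _ _ (fun t => [set p in s t]) T); last first.
  move=> t t' tT tT' E; have := congr1 cells E; rewrite !cellsK// => /(congr1 (map hook_pos)).
  rewrite !sK// => /(congr1 unzip1); rewrite !unzip1_zip ?size_map ?size_tuple//.
  by move/(inj_map val_inj)/val_inj.
apply: eq_card => A; rewrite inE; apply/eqP/imsetP => [E|[t tT ->]].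
  have sz : size (map (fun p => Ordinal (layer_bound (cell_point p))) (cells A)) == size w.
    by rewrite size_map -E size_map.
  exists (Tuple sz).
    rewrite inE /= -map_comp -E /= zip_map sorted_map.
    by apply: sorted_filter grid_sorted; apply: hook_lt_trans.
  apply/setP => p; rewrite inE /s /= -map_comp -[X in zip _ X]E zip_map -map_comp.
  rewrite (@eq_map _ _ _ id) ?map_id; last by move=> q /=; rewrite findK.
  by rewrite mem_filter mem_grid andbT.
rewrite /cell_word cellsK//.
have -> : [seq content (cell_point p) | p <- s t] = unzip2 (map hook_pos (s t)).
  by rewrite /unzip2 -map_comp.
by rewrite sK// unzip2_zip// size_map size_tuple.
Qed.
End Hooks.

(** * Maya diagrams and oscillating tableaux *)

Implicit Types (lam mu nu xi : natseq).

Lemma eq_of_ltn m n : (forall y, (y < m) = (y < n)) -> m = n.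
Proof. by move=> H; have := H m; have := H n; lia. Qed.

Lemma swapK c : involutive (swap c).
Proof.
move=> M; apply/funext => p; rewrite /swap eqxx.
have -> : (c - 1 == c)%R = false by lia.
have -> : (c == c - 1)%R = false by lia.
by have [->|_] := eqVneq p (c - 1)%R; rewrite ?eqxx//; have [->|] := eqVneq p c; rewrite ?eqxx.
Qed.

(** With rows numbered from 1 these are the values lambda_i - i; the zero rows fill all sufficiently
    negative positions. *)
Definition maya (lam : natseq) (p : int) : bool :=
  `[< exists i : nat, ((lam i)%:Z - i.+1%:Z)%R = p >].

Lemma mayaP lam p : reflect (exists i : nat, ((lam i)%:Z - i.+1%:Z)%R = p) (maya lam p).
Proof. exact: asboolP. Qed.

Lemma empty_partE i : empty_part i = 0.
Proof. by rewrite fsfunE. Qed.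

Lemma maya_empty : maya empty_part = vacuum.
Proof.
apply/funext => p; rewrite /vacuum; apply/mayaP/idP => [[i]|p0].
  by rewrite empty_partE; lia.
by exists (absz p).-1; rewrite empty_partE; lia.
Qed.

(** The positions of the rows strictly decrease, so each row is recovered from the rank of its
    position. *)
Lemma maya_inj lam mu : is_partition lam -> is_partition mu ->
  maya lam = maya mu -> lam = mu.
Proof.
move=> dl dm E; apply/fsfunP => i.
elim/ltn_ind: i => i IH.
have le nu xi : is_partition nu -> is_partition xi -> maya nu = maya xi ->
    (forall k, k < i -> nu k = xi k) -> nu i <= xi i.
  move=> dn dx Enx eqk.
  have : maya xi ((nu i)%:Z - i.+1%:Z)%R by rewrite -Enx; apply/mayaP; exists i.
  case/mayaP => k kE; case: (ltnP k i) => ki.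
    have := eqk k ki; have := is_partitionP _ dn _ _ (ltnW ki).
    by clear -ki kE; lia.
  have := is_partitionP _ dx _ _ ki; by clear -ki kE; lia.
by apply/eqP; rewrite eqn_leq !le// => k /IH.
Qed.

Lemma Young_addP lam mu i j : is_partition lam -> is_partition mu ->
  (Young mu = (Young lam `|` [set (i.+1, j.+1)])%classic /\ ~ Young lam (i.+1, j.+1)) <->
  [/\ lam i = j, mu i = j.+1 & forall k, k != i -> mu k = lam k].
Proof.
move=> dl dm; split=> [[E np]|[li mi mk]].
  have eqY k y : (y < mu k) = (y < lam k) || ((k == i) && (y == j)).
    apply/idP/idP.
      move/(YoungE _ _ _ dm); rewrite E => -[/(YoungE _ _ _ dl) -> //|[-> ->]].
      by rewrite !eqxx orbT.
    case/orP=> [/(YoungE _ _ _ dl) H|/andP[/eqP-> /eqP->]]; apply/(YoungE _ _ _ dm).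
      by rewrite E; left.
    by rewrite E; right.
  have nj : ~~ (j < lam i) by apply/negP => /(YoungE _ _ _ dl).
  have := eqY i (lam i); have := eqY i j; have := eqY i (mu i).-1; have := eqY i j.+1.
  rewrite !eqxx /= => h1 h2 h3 h4; split; [by clear -h1 h2 h3 h4 nj; lia..|].
  by move=> k /negbTE ki; apply: eq_of_ltn => y; rewrite eqY ki orbF.
split; last by move/(YoungE _ _ _ dl); rewrite li ltnn.
apply/seteqP; split=> -[[|k] [|y]]; try by [case|case=> -[]].
  move/(YoungE _ _ _ dm); have [->|ki] := eqVneq k i.
    rewrite mi ltnS leq_eqVlt => /predU1P[->|]; first by right.
    by rewrite -{1}li => /(YoungE _ _ _ dl) H; left.
  by rewrite mk// => /(YoungE _ _ _ dl) H; left.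
move=> H; apply/(YoungE _ _ _ dm); case: H => [/(YoungE _ _ _ dl)|[-> ->]]; last by rewrite mi.
have [->|ki] := eqVneq k i; last by rewrite mk.
by rewrite mi li; apply: ltnW.
Qed.

Lemma maya_add lam mu i j (c := (j%:Z - i%:Z)%R) : is_partition lam -> is_partition mu ->
  lam i = j -> mu i = j.+1 -> (forall k, k != i -> mu k = lam k) ->
  [/\ maya lam (c - 1)%R = true, maya lam c = false & maya mu = swap c (maya lam)].
Proof.
rewrite {}/c => dl dm li mi mk.
(* Rows above [i] have positions beyond [c] and rows below it positions before [c - 1]; only row [i]
   moves, from [c - 1] to [c]. *)
have far k : [\/ k = i, k < i /\ j < lam k | i < k /\ lam k <= j].
  case: (ltngtP k i) => [ki|ki|->]; [constructor 2|constructor 3|by constructor].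
    split=> //; rewrite -mk ?ltn_eqF// -mi; exact: (is_partitionP _ dm _ _ (ltnW ki)).
  by split=> //; rewrite -li; apply: (is_partitionP _ dl _ _ (ltnW ki)).
have m1 : maya lam (j%:Z - i%:Z - 1)%R.
  by apply/mayaP; exists i; rewrite li; clear; lia.
have m2 : maya lam (j%:Z - i%:Z)%R = false.
  apply/negP => /mayaP[k kE]; have := far k.
  case=> [ki|[ki kj]|[ki kj]]; [|by clear -kE ki kj; lia..].
  by rewrite ki li in kE; clear -kE; lia.
split=> //; apply/funext => p; rewrite /swap.
case: eqP => [->|p1].
  rewrite m2; apply/negP => /mayaP[k kE].
  case: (far k) kE => [->|[ki kj]|[ki kj]].
  - by rewrite mi; clear; lia.
  - by rewrite mk ?ltn_eqF//; clear -ki kj; lia.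
  - by rewrite mk ?gtn_eqF//; clear -ki kj; lia.
case: eqP => [->|p2].
  by rewrite m1; apply/mayaP; exists i; rewrite mi; clear; lia.
apply/mayaP/mayaP => -[k kE]; exists k; move: kE; have [->|ki] := eqVneq k i.
- by rewrite mi; clear -p2; lia.
- by rewrite mk.
- by rewrite li; clear -p1; lia.
- by rewrite mk.
Qed.

(** Since [swap] is an involution, removal of a square follows from [maya_add] with the partitions
    interchanged. *)
Lemma maya_differ lam mu p : is_partition lam -> is_partition mu ->
  differ_at lam mu p ->
  maya lam (p.2%:Z - p.1%:Z - 1)%R != maya lam (p.2%:Z - p.1%:Z)%R /\
  maya mu = swap (p.2%:Z - p.1%:Z)%R (maya lam).
Proof.
have add nu xi : is_partition nu -> is_partition xi ->
    Young xi = (Young nu `|` [set p])%classic -> ~ Young nu p ->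
    exists i j, [/\ p = (i.+1, j.+1), nu i = j, xi i = j.+1 & forall k, k != i -> xi k = nu k].
  move=> dn dx E np; have : Young xi p by rewrite E; right.
  case: p E np => -[|i] [|j] E np; try by case.
  by move=> _; have [] := proj1 (Young_addP _ _ i j dn dx) (conj E np); exists i, j.
move=> dl dm [] [E np].
  have [i [j [-> mi li mk]]] := add _ _ dm dl E np.
  have [] := maya_add _ _ _ _ dm dl mi li mk.
  have -> : (j%:Z - i%:Z = j.+1%:Z - i.+1%:Z)%R by clear; lia.
  move=> /= h1 h2 ->; rewrite swapK; split=> //.
  by rewrite /swap !eqxx ifF ?h1 ?h2//; clear; lia.
have [i [j [-> li mi mk]]] := add _ _ dl dm E np.
have [] := maya_add _ _ _ _ dl dm li mi mk.
have -> : (j%:Z - i%:Z = j.+1%:Z - i.+1%:Z)%R by clear; lia.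
by move=> /= -> ->.
Qed.

Definition set_part (lam : natseq) (i n : nat) : natseq :=
  [fsfun k in (i |` finsupp lam)%fset => if k == i then n else lam k].

Lemma set_partE lam i n k : set_part lam i n k = if k == i then n else lam k.
Proof.
rewrite fsfunE !inE; case: eqP => //= _; case: ifP => // /negbT.
by rewrite memNfinsupp => /eqP.
Qed.

(** If row [i] occupies [c - 1] and [c] is free, row [i] can grow: the row above, if equally long,
    would occupy [c]. If row [i] occupies [c] and [c - 1] is free, it can shrink: the row below, if
    equally long, would occupy [c - 1]. *)
Lemma maya_toggle lam c : is_partition lam -> maya lam (c - 1)%R != maya lam c ->
  exists mu p, [/\ is_partition mu, differ_at lam mu p & c = (p.2%:Z - p.1%:Z)%R].
Proof.
move=> dl; case m1: (maya lam (c - 1)%R); case m2: (maya lam c) => // _.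
  have /mayaP[i iE] := m1; pose mu := set_part lam i (lam i).+1.
  have dm : is_partition mu.
    case=> // k _; rewrite /part /= !set_partE.
    case: eqP => [ki|_]; last first.
      by case: eqP => [<-|_]; [apply: leqW; apply: (dl k.+1)|apply: (dl k.+1)].
    rewrite ifF; last by clear -ki; lia.
    have := dl k.+1 isT; rewrite /part /= ki leq_eqVlt => /predU1P[E|//].
    by have /mayaP[] := negbT m2; exists k; rewrite -E; clear -iE ki; lia.
  exists mu, (i.+1, (lam i).+1); split=> //; last by rewrite /=; clear -iE; lia.
  right; apply/(Young_addP _ _ _ _ dl dm); split=> //; first by rewrite set_partE eqxx.
  by move=> k /negbTE ki; rewrite set_partE ki.
have /mayaP[i iE] := m2; pose mu := set_part lam i (lam i).-1.
have lt : lam i.+1 < lam i.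
  have := dl i.+1 isT; rewrite /part /= leq_eqVlt => /predU1P[E|//].
  by have /mayaP[] := negbT m1; exists i.+1; rewrite E; clear -iE; lia.
have dm : is_partition mu.
  case=> // k _; rewrite /part /= !set_partE.
  case: eqP => [ki|_]; last first.
    by case: eqP => [ki|_]; [move: lt; rewrite ki; clear; lia|apply: (dl k.+1)].
  rewrite ifF; last by clear -ki; lia.
  by have := dl k.+1 isT; rewrite /part /= ki; clear; lia.
exists mu, (i.+1, (lam i).-1.+1); split=> //; last by rewrite /=; clear -iE lt; lia.
left; apply/(Young_addP _ _ _ _ dm dl); split; [by rewrite set_partE eqxx|by clear -lt; lia|].
by move=> k /negbTE ki; rewrite set_partE ki.
Qed.

Lemma DeltaE lam mu p : differ_at lam mu p -> Delta lam mu = (p.2%:Z - p.1%:Z)%R.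
Proof.
move=> d; rewrite /Delta; have /= := @xgetPex _ (0, 0) [set p | differ_at lam mu p]%classic.
by move=> /(_ (ex_intro _ p d)) /(differ_at_unique _ _ _ _ d) <-.
Qed.

Definition tableau_word {l : nat} (eta : l.+1.-tuple natseq) : seq int :=
  [seq Omega eta k | k <- iota 1 l].

Lemma size_tableau_word l (eta : l.+1.-tuple natseq) : size (tableau_word eta) = l.
Proof. by rewrite size_map size_iota. Qed.

Lemma tableau_prefix lam l (eta : l.+1.-tuple natseq) k : OT lam l eta -> k <= l ->
  admissible vacuum (take k (tableau_word eta)) /\
  maya (eta_at eta k) = run vacuum (take k (tableau_word eta)).
Proof.
move=> [dec eta0 _ sq]; elim: k => [|k IH] kl; first by rewrite take0 eta0 maya_empty.
have [adm mE] := IH (ltnW kl).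
rewrite (take_nth 0%R) ?size_tableau_word// -cats1 admissible_cat run_cat adm -mE /= andbT.
rewrite (nth_map 0) ?size_iota// nth_iota// add1n.
have [p pd] := sq k.+1 kl; rewrite /Omega /= (DeltaE _ _ _ pd).
exact: (maya_differ _ _ _ (dec _ (ltnW kl)) (dec _ kl) pd).
Qed.

Lemma tableau_admissible lam l (eta : l.+1.-tuple natseq) : OT lam l eta ->
  admissible vacuum (tableau_word eta) /\ maya lam = run vacuum (tableau_word eta).
Proof.
move=> O; have := tableau_prefix _ _ _ l O (leqnn l).
by have [_ _ -> _] := O; rewrite take_oversize ?size_tableau_word.
Qed.

Lemma tableau_word_inj lam l (eta xi : l.+1.-tuple natseq) :
  OT lam l eta -> OT lam l xi -> tableau_word eta = tableau_word xi -> eta = xi.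
Proof.
move=> Oe Ox E; apply/val_inj/(@eq_from_nth _ empty_part); rewrite ?size_tuple// => k kl.
have [_ e] := tableau_prefix _ _ _ k Oe kl; have [_ x] := tableau_prefix _ _ _ k Ox kl.
have [[de _ _ _] [dx _ _ _]] := (Oe, Ox).
by apply: (maya_inj _ _ (de k kl) (dx k kl)); rewrite e x E.
Qed.

Lemma toggle_chain lam w : is_partition lam -> admissible (maya lam) w ->
  exists s : seq natseq, [/\ size s = size w,
    forall k, k <= size w -> is_partition (nth empty_part (lam :: s) k)
  & forall k, k < size w ->
      exists2 p, differ_at (nth empty_part (lam :: s) k) (nth empty_part s k) p
      & nth 0%R w k = (p.2%:Z - p.1%:Z)%R].
Proof.
elim: w lam => [|c w IH] lam dl; first by exists [::]; split=> // -[].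
case/andP=> ne adm; have [mu [p [dm pd cE]]] := maya_toggle _ _ dl ne.
have [_ mE] := maya_differ _ _ _ dl dm pd; rewrite -cE in mE.
rewrite -mE in adm; have [s [sz dec sq]] := IH mu dm adm.
exists (mu :: s); split=> [|[|k] //|[|k]] /=; first by rewrite sz.
- exact: dec.
- by exists p.
- exact: sq.
Qed.

Lemma tableau_exists l lam w : is_partition lam -> size w = l ->
  admissible vacuum w -> maya lam = run vacuum w ->
  exists2 eta, OT lam l eta & tableau_word eta = w.
Proof.
move=> dl <- adm mE.
have d0 : is_partition empty_part by move=> i _; rewrite /part !empty_partE.
rewrite -maya_empty in adm; have [s [sz dec sq]] := toggle_chain _ _ d0 adm.
have sz1 : size (empty_part :: s) == (size w).+1 by rewrite /= sz.
pose eta := Tuple sz1.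
have wE : tableau_word eta = w.
  apply: (@eq_from_nth _ 0%R); rewrite size_tableau_word// => k kw.
  rewrite (nth_map 0) ?size_iota// nth_iota// add1n.
  by have [p pd ->] := sq k kw; rewrite /Omega /eta_at /= (DeltaE _ _ _ pd).
exists eta => //; have O : OT (eta_at eta (size w)) (size w) eta.
  by split=> // -[//|k] kw; have [p pd _] := sq k kw; exists p.
have [_ mE'] := tableau_admissible _ _ _ O.
have -> // : lam = eta_at eta (size w).
by apply: maya_inj => //; [apply: dec|rewrite mE mE' wE].
Qed.

Lemma ascents_word prec l (eta : l.+1.-tuple natseq) :
  ascents prec eta =
  word_ascents prec (head 0%R (tableau_word eta)) (behead (tableau_word eta)).
Proof.
have gen (F : nat -> int) i n : count (fun k => prec (F k) (F k.+1)) (iota i n) =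
    word_ascents prec (F i) [seq F k | k <- iota i.+1 n].
  by elim: n i => //= n IH i; rewrite IH.
by case: l eta => [|l] eta; rewrite /ascents /tableau_word /= ?gen.
Qed.

(** * The partition of the end points *)

Definition sorted_elts (s : {fset nat}) : seq nat := sort leq (enum_fset s).

Lemma size_sorted_elts (s : {fset nat}) : size (sorted_elts s) = #|` s|.
Proof. by rewrite size_sort. Qed.

Lemma mem_sorted_elts (s : {fset nat}) : sorted_elts s =i s.
Proof. by move=> x; rewrite mem_sort. Qed.

Lemma sorted_elts_ltn (s : {fset nat}) : sorted ltn (sorted_elts s).
Proof. by rewrite ltn_sorted_uniq_leq sort_uniq fset_uniq sort_sorted//; apply: leq_total. Qed.

Lemma map_elt (f : nat -> nat) (s : {fset nat}) :
  [seq f (elt s k) | k <- iota 1 #|` s|] = [seq f x | x <- sorted_elts s].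
Proof.
apply: (@eq_from_nth _ 0) => [|k]; rewrite !size_map size_iota ?size_sorted_elts// => ks.
by rewrite !(nth_map 0) ?size_iota ?size_sorted_elts// nth_iota// /elt add1n.
Qed.

Lemma sorted_sub (n : nat) (t : seq nat) : sorted ltn t -> all (fun x => x <= n) t ->
  sorted gtn [seq n - x | x <- t].
Proof.
move=> st al; rewrite sorted_map; elim: t st al => //= x [//|y t] IH /= /andP[xy st] /andP[xn al].
by have /= -> := IH st al; rewrite andbT; case/andP: al => yn _; clear -xy xn yn; lia.
Qed.

Lemma frobenius_diag gamma delta nu i : is_frobenius gamma delta nu ->
  (i < nu i) = (i < size gamma).
Proof.
case=> dec card _.
have [||H1 H2] := @card_eq_initial _ _ _ _ card i.+1 isT.
- move=> k j /= k1 kj [j1 jP]; split=> //.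
  by apply: (leq_trans kj (leq_trans jP _)); apply: (is_partitionP nu dec); clear -kj; lia.
- by move=> j [].
by apply/idP/idP => [H|/H2[]//]; apply: H1.
Qed.

(** Occupied nonnegative positions come from the rows that meet the diagonal, free negative
    positions from the columns that meet it. *)
Lemma frobenius_maya gamma delta nu (p : int) : is_frobenius gamma delta nu ->
  size gamma = size delta ->
  maya nu p = if (0 <= p)%R then absz p \in gamma else absz (p + 1)%R \notin delta.
Proof.
move=> F sz; have diag i := frobenius_diag _ _ _ i F; have [dec _ frob] := F.
case: ifP => p0.
  apply/mayaP/idP => [[i iE]|/(nthP 0)[i ir iE]].
    have ir : i < size gamma by rewrite -diag; clear -iE p0; lia.
    have [/= gE _] := frob i.+1 ir; rewrite /part /= in gE.
    have -> : absz p = nth 0 gamma i by clear -gE iE; lia.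
    exact: mem_nth.
  exists i; have [/= gE _] := frob i.+1 ir; rewrite /part /= in gE.
  by rewrite gE iE; clear -p0; lia.
apply/idP/idP => [/mayaP[i iE]|].
  apply/(nthP 0) => -[j]; rewrite -sz => jr jE.
  have [/= _ dE] := frob j.+1 jr; rewrite jE in dE.
  by have := leq_part_conj _ dec j.+1 i isT; clear -dE iE p0; lia.
apply: contraNT => /mayaP nm.
(* For the first row [i] whose position is at most the free [p], column [j = p + i + 1] has length
   exactly [i], so its leg is [i - j = -(p + 1)]. *)
have ex : exists i : nat, ((nu i)%:Z - i.+1%:Z <= p)%R.
  exists (absz p + nu 0); have := is_partitionP _ dec 0 (absz p + nu 0) isT; by clear; lia.
case: (ex_minnP ex) => i ile imin.
have ilt : ((nu i)%:Z - i.+1%:Z < p)%R.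
  by rewrite lt_neqAle ile andbT; apply/eqP => iE; apply: nm; exists i.
pose j := absz (p + i.+1%:Z)%R.
have j1 : 0 < j by rewrite /j; clear -ilt p0; lia.
have cE : conj_part nu j = i.
  apply: eq_of_ltn => t; rewrite -leq_part_conj//; case: (ltnP t i) => ti.
    have : ~~ ((nu i.-1)%:Z - i.-1.+1%:Z <= p)%R.
      by apply/negP => /imin; clear -ti; lia.
    have := is_partitionP _ dec t i.-1; rewrite /j; clear -ti ilt; lia.
  have := is_partitionP _ dec _ _ ti; rewrite /j; clear -ilt; lia.
have jr : j.-1 < size gamma.
  rewrite -diag prednK// leq_part_conj// cE; rewrite /j; clear -ilt p0; lia.
have [|_ dE] := frob j; first by rewrite j1 /=; clear -j1 jr; lia.
have -> : absz (p + 1)%R = nth 0 delta j.-1.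
  by move: dE; rewrite cE /j; clear -ilt p0; lia.
by rewrite mem_nth// -sz.
Qed.

(** * The complement in the rectangle and its Maya diagram *)

Section Complement.
Variables (a b : nat) (alpha beta : {fset nat}) (ab_BP : BP a b (alpha, beta)).

Let alphaP i : i \in alpha -> 1 <= i <= a. Proof. by case: ab_BP => H _ _; apply: H. Qed.
Let betaP j : j \in beta -> 1 <= j <= b. Proof. by case: ab_BP => _ H _; apply: H. Qed.
Let card_ab : #|` alpha| = #|` beta|. Proof. by case: ab_BP. Qed.

Let gamma := [seq b - x | x <- sorted_elts beta].
Let delta := [seq a - x | x <- sorted_elts alpha].
Let nu := frobenius gamma delta.

Lemma lambda_ofE i : lambda_of a b alpha beta i = if i < a then b - nu (a - i).-1 else 0.
Proof. by rewrite /lambda_of -card_ab {1}card_ab !map_elt fsfunE !inE mem_iota. Qed.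

Let nu_frob : is_frobenius gamma delta nu.
Proof.
apply: frobeniusP.
- apply: sorted_sub; first exact: sorted_elts_ltn.
  by apply/allP => x; rewrite mem_sorted_elts => /betaP/andP[].
- apply: sorted_sub; first exact: sorted_elts_ltn.
  by apply/allP => x; rewrite mem_sorted_elts => /alphaP/andP[].
- by rewrite !size_map !size_sorted_elts.
Qed.

Let nu_dec : is_partition nu. Proof. by case: nu_frob. Qed.

Let nu0 : nu 0 <= b.
Proof.
have diag := frobenius_diag _ _ _ 0 nu_frob; have [_ _ frob] := nu_frob.
case: (posnP (size gamma)) diag => [_|r0 _]; first by clear; lia.
have [/= gE _] := frob 1 r0; rewrite /part /= in gE.
have : nth 0 gamma 0 < b.
  have /mapP[x] := mem_nth 0 r0; rewrite mem_sorted_elts => /betaP + ->.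
  by clear; lia.
by clear -gE; lia.
Qed.

Let nua t : a <= t -> nu t = 0.
Proof.
move=> ta; have diag := frobenius_diag _ _ _ 0 nu_frob; have [_ _ frob] := nu_frob.
case: (posnP (size gamma)) diag => [_|r0 _].
  by have := is_partitionP _ nu_dec 0 t isT; clear; lia.
have [/= _ dE] := frob 1 r0.
have : nth 0 delta 0 < a.
  have d0 : 0 < size delta by rewrite size_map size_sorted_elts card_ab -size_sorted_elts -(size_map (subn b)).
  have /mapP[x] := mem_nth 0 d0; rewrite mem_sorted_elts => /alphaP + ->.
  by clear; lia.
have := leq_part_conj _ nu_dec 1 t isT; clear -dE ta; lia.
Qed.

Lemma lambda_of_partition : is_partition (lambda_of a b alpha beta).
Proof.
case=> // i _; rewrite /part /= !lambda_ofE; case: ifP => // ia; rewrite ifT; last by clear -ia; lia.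
apply: leq_sub2l; apply: (is_partitionP _ nu_dec); clear; lia.
Qed.

Lemma maya_lambda_of : maya (lambda_of a b alpha beta) = profile_target a b alpha beta.
Proof.
(* The half turn of the rectangle sends row [i] to row [a - 1 - i], counted from 0, and so reflects
   the positions of the window. *)
have refl (p : int) : (- a%:Z <= p < b%:Z)%R ->
    maya (lambda_of a b alpha beta) p = maya nu (b%:Z - a%:Z - 1 - p)%R.
  move=> pab; apply/mayaP/mayaP => -[i].
    rewrite lambda_ofE; case: ifP => ia iE; last by clear -ia iE pab; lia.
    exists (a - i).-1; have := is_partitionP _ nu_dec 0 (a - i).-1 isT.
    by move: nu0; clear -ia iE; lia.
  case: (ltnP i a) => ia iE; last by rewrite nua// in iE; clear -ia iE pab; lia.
  exists (a - i).-1; rewrite lambda_ofE ifT; last by clear -ia; lia.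
  have -> : (a - (a - i).-1).-1 = i by clear -ia; lia.
  by have := is_partitionP _ nu_dec 0 i isT; move: nu0; clear -ia iE; lia.
apply/funext => p; rewrite /profile_target; case: ifP => pa.
  apply/mayaP; exists (absz p).-1; rewrite lambda_ofE ifF; clear -pa; lia.
have sz : size gamma = size delta by rewrite !size_map !size_sorted_elts.
case: ifP => pab.
  rewrite refl; last by clear -pa pab; lia.
  rewrite (frobenius_maya _ _ _ _ nu_frob sz) ifT; last by clear -pa pab; lia.
  apply/mapP/idP => [[x]|H].
    rewrite mem_sorted_elts => xb E; suff -> : (absz (p + a%:Z)%R).+1 = x by [].
    by have := betaP _ xb; clear -E pa pab; lia.
  exists (absz (p + a%:Z)%R).+1; first by rewrite mem_sorted_elts.
  by have := betaP _ H; clear -pa pab; lia.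
case: ifP => pb.
  rewrite refl; last by clear -pa pb; lia.
  rewrite (frobenius_maya _ _ _ _ nu_frob sz) ifF; last by clear -pab; lia.
  congr (~~ _); apply/mapP/idP => [[x]|H].
    rewrite mem_sorted_elts => xb E; suff -> : absz (b%:Z - p)%R = x by [].
    by have := alphaP _ xb; clear -E pb pab; lia.
  exists (absz (b%:Z - p)%R); first by rewrite mem_sorted_elts.
  by have := alphaP _ H; clear -pb pab; lia.
apply/mayaP => -[i]; rewrite lambda_ofE; case: ifP => _; clear -pb; lia.
Qed.
End Complement.

(** * Paths as row functions *)

Section Rows.
Variables (a b : nat).
Implicit Types (x y i j s m : nat) (f g : nat -> nat) (Q : seq (nat * nat)).

(* f s is the row of the path on the diagonal j - i + a = s.  The path is
   prolonged by a vertical ray below its start (a, y) and a horizontal ray to the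
   right of its end (x, b), so that every path meets every diagonal s >= 0. *)
Record lattice_row x y f : Prop := LatticeRow {
  row_first : f 0 = a + y;
  row_last : f (a + b) = x;
  row_step : forall s, f s = f s.+1 \/ f s = (f s.+1).+1;
  row_up : forall s, a < f s -> f s = (f s.+1).+1;
  row_right : forall s, a + b < f s + s -> f s.+1 = f s }.

(* f s + f s.+1 is 2i for a step to the right in row i and 2i - 1 for a step up
   from row i, which numbers the edges between two diagonals from the north-west
   to the south-east. *)
Definition below_row f g : Prop := forall s, f s + f s.+1 < g s + g s.+1.

(** The case [s < y] is the vertical ray; the default [(x, 0)] of [nth] supplies the row of the
    horizontal ray. *)
Definition row_of x y Q s : nat :=
  if s < y then a + y - s else (nth (x, 0) Q (s - y)).1.

Definition path_of x y f : seq (nat * nat) :=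
  [seq (f s, f s + s - a) | s <- iota y (a + b - x - y).+1].

Section OneRow.
Variables (x y : nat) (f : nat -> nat).
Hypotheses (x1 : 0 < x) (xa : x <= a) (y1 : 0 < y) (yb : y <= b).
Hypothesis fP : lattice_row x y f.

Lemma row_mono s s' : s <= s' -> f s' <= f s /\ f s + s <= f s' + s'.
Proof.
elim: s' => [|s' IH]; first by rewrite leqn0 => /eqP ->.
rewrite leq_eqVlt => /predU1P[-> //|]; rewrite ltnS => /IH.
have := row_step _ _ _ fP s'; clear; lia.
Qed.

Lemma row_early s : s <= y -> f s = a + y - s.
Proof.
elim: s => [_|s IH sy]; first by rewrite (row_first _ _ _ fP) subn0.
have := row_up _ _ _ fP s; rewrite IH ?(ltnW sy)//; clear -sy; lia.
Qed.

Lemma row_le_a s : y <= s -> f s <= a.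
Proof. by move=> /row_mono [+ _]; rewrite (row_early y)//; clear; lia. Qed.

Lemma row_freeze s d : a + b < f s + s -> f (s + d) = f s.
Proof.
move=> H; elim: d => [|d IH]; first by rewrite addn0.
by rewrite addnS (row_right _ _ _ fP) IH//; clear -H; lia.
Qed.

(** For [s <= a + b], either the path is already beyond column b and frozen at its final row, or its
    column is at most b, which forces [f s <= x]. *)
Lemma row_late s : a + b <= s + x -> f s = x.
Proof.
move=> sx; have fl := row_last _ _ _ fP.
have late s' : a + b <= s' -> f s' = x.
  move=> ss; rewrite -(subnKC ss) row_freeze fl//; clear -x1; lia.
case: (leqP s (a + b)) => [sab|/ltnW/late //].
have [lo _] := row_mono _ _ sab; rewrite fl in lo.
case: (ltnP (a + b) (f s + s)) => H; last by clear -H lo sx; lia.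
by rewrite -(row_freeze _ (a + b - s) H) subnKC.
Qed.

Lemma row_ge s : x <= f s.
Proof.
case: (leqP s (a + b)) => [/row_mono[]|/ltnW H]; first by rewrite (row_last _ _ _ fP).
by rewrite row_late//; clear -H; lia.
Qed.

Lemma row_col s : s + x <= a + b -> f s + s <= a + b.
Proof.
move=> sx; have [|_] := row_mono s (a + b - x); first by clear -sx; lia.
by rewrite [f (a + b - x)]row_late; clear -sx; lia.
Qed.

Lemma row_col_ge s : a + y <= f s + s.
Proof. by have [_] := row_mono 0 s isT; rewrite (row_first _ _ _ fP) addn0. Qed.

Lemma size_path_of : size (path_of x y f) = (a + b - x - y).+1.
Proof. by rewrite size_map size_iota. Qed.

Lemma onth_path_of m : onth (path_of x y f) m =
  if m <= a + b - x - y then Some (f (y + m), f (y + m) + (y + m) - a) else None.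
Proof.
rewrite /path_of onth_map; case: (leqP m (a + b - x - y)) => mL.
  have := onthTE (iota y (a + b - x - y).+1) m; rewrite size_iota ltnS mL.
  by case E: (onth _ m) => [z|//] _; have := onth_nth 0 _ _ _ E; rewrite nth_iota// => <-.
by rewrite onth_default// size_iota.
Qed.

Lemma path_of_paths : paths a b x y (path_of x y f).
Proof.
have fy : f y = a by rewrite row_early// addnK.
have steps n s : y <= s -> let Q := [seq (f s, f s + s - a) | s <- iota s.+1 n] in
    path path_step (f s, f s + s - a) Q /\ last (f s, f s + s - a) Q = (f (s + n), f (s + n) + (s + n) - a).
  elim: n s => [|n IH] s ys /=; first by rewrite addn0.
  have [|h1 h2] := IH s.+1; first exact: leqW.
  rewrite h1 h2 andbT addSnnS; split=> //; rewrite /path_step /=.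
  have := row_col_ge s; have := row_step _ _ _ fP s; clear -y1 => -[E|E] ge; apply/orP; [left|right].
    by apply/eqP; congr (_, _); lia.
  by apply/eqP; congr (_, _); lia.
have [h1 h2] := steps (a + b - x - y) y (leqnn y).
rewrite /= in h1 h2; rewrite fy addKn in h1 h2.
exists [seq (f s, f s + s - a) | s <- iota y.+1 (a + b - x - y)]; first by rewrite /path_of /= fy addKn.
split=> //; rewrite h2 row_late; [|clear -x1 xa y1 yb; lia].
by congr (_, _); clear -x1 xa y1 yb; lia.
Qed.

Lemma row_of_path_of : row_of x y (path_of x y f) = f.
Proof.
apply/funext => s; rewrite /row_of; case: ltnP => sy; first by rewrite row_early// ltnW.
have := onth_path_of (s - y); rewrite subnKC//; case: leqP => sL E.
  by rewrite (onth_nth _ _ _ _ E).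
rewrite nth_default ?size_path_of//= row_late//; clear -sL sy xa yb; lia.
Qed.

Lemma mem_path_of i j : 1 <= i <= a -> 1 <= j <= b ->
  ((i, j) \in path_of x y f) = (f (j + a - i) == i).
Proof.
move=> ia jb; apply/mapP/eqP => [[s]|E].
  rewrite mem_iota => sy [iE jE]; have := row_col_ge s => ge.
  by have -> : j + a - i = s by clear -ia jb ge iE jE y1; lia.
exists (j + a - i); last by rewrite E; congr (_, _); clear -ia; lia.
rewrite mem_iota; apply/andP; split.
  rewrite leqNgt; apply/negP => lt; have := row_early _ (ltnW lt); rewrite E; clear -lt ia; lia.
case: (leqP (a + b) (j + a - i + x)) => H; last by clear -H ia jb xa yb; lia.
by have := row_late _ H; rewrite E; clear -H ia jb xa yb; lia.
Qed.

End OneRow.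

Section OnePath.
Variables (x y : nat) (Q : seq (nat * nat)).
Hypotheses (x1 : 0 < x) (xa : x <= a) (y1 : 0 < y) (yb : y <= b).
Hypothesis QP : paths a b x y Q.

Lemma paths_nth m : m < size Q -> (nth (x, 0) Q m).2 + a = (nth (x, 0) Q m).1 + y + m.
Proof.
case: QP => Q' -> [pQ _] /=; elim: m => [|m IH] mQ /=; first by lia.
have /= {IH} := IH (ltnW mQ); have /= := pathP (x, 0) pQ m mQ.
case: (nth _ (_ :: _) m) => i j; case: (nth _ _ m) => i' j'; rewrite /path_step /=.
by case/orP => /eqP[-> ->]; lia.
Qed.

Lemma size_paths : size Q = (a + b - x - y).+1 /\ nth (x, 0) Q (a + b - x - y) = (x, b).
Proof.
have := paths_nth (size Q).-1; case: QP => Q' -> [pQ lQ] /=.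
rewrite nth_last /= lQ => /(_ (ltnSn _)) /= H.
have sz : size Q' = a + b - x - y by clear -H xa yb; lia.
by rewrite -sz; split=> //; rewrite -[X in nth _ _ X]/((size ((a, y) :: Q')).-1) nth_last /= lQ.
Qed.

Lemma row_of_steps s : y <= s ->
  row_of x y Q s = row_of x y Q s.+1 \/ row_of x y Q s = (row_of x y Q s.+1).+1.
Proof.
move=> ys; have [sz nl] := size_paths; rewrite /row_of !ifF; [|clear -ys; lia..].
have -> : s.+1 - y = (s - y).+1 by clear -ys; lia.
case: (ltngtP (s - y) (a + b - x - y)) => sL.
- case: QP sz => Q' -> [pQ _] /= [sz]; have := pathP (x, 0) pQ (s - y).
  rewrite sz => /(_ sL) /=.
  case: (nth _ (_ :: _) (s - y)) => i j; case: (nth _ _ (s - y)) => i' j'; rewrite /path_step /=.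
  by case/orP => /eqP[-> _]; [left|right].
- by left; rewrite !nth_default ?sz//; clear -sL; lia.
- by left; rewrite sL nl nth_default ?sz.
Qed.

Lemma row_of_lattice : lattice_row x y (row_of x y Q).
Proof.
have [sz nl] := size_paths.
have late s : a + b <= s + x -> row_of x y Q s = x.
  move=> sx; rewrite /row_of ifF; last by clear -sx xa y1 yb; lia.
  case: (ltngtP (s - y) (a + b - x - y)) => sL.
  - by clear -sx sL; lia.
  - by rewrite nth_default ?sz.
  - by rewrite sL nl.
have at_y : row_of x y Q y = a.
  by rewrite /row_of ltnn subnn; case: QP => Q' -> _.
have step s : row_of x y Q s = row_of x y Q s.+1 \/ row_of x y Q s = (row_of x y Q s.+1).+1.
  case: (leqP y s) => sy; first exact: row_of_steps.
  case: (ltngtP s.+1 y) => sy'; [|by clear -sy sy'; lia|].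
    by rewrite /row_of !ifT//; clear -sy sy'; lia.
  by rewrite sy' at_y /row_of ifT//; clear -sy'; lia.
have mono s s' : s <= s' -> row_of x y Q s' <= row_of x y Q s /\
    row_of x y Q s + s <= row_of x y Q s' + s'.
  elim: s' => [|s' IH]; first by rewrite leqn0 => /eqP ->.
  rewrite leq_eqVlt => /predU1P[-> //|]; rewrite ltnS => /IH.
  have := step s'; clear; lia.
split=> // [||s sa|s sab].
- by rewrite /row_of y1 subn0.
- by apply: late; clear; lia.
- case: (leqP y s) => sy; first by have [] := mono _ _ sy; rewrite at_y; clear -sa; lia.
  case: (ltngtP s.+1 y) => sy'; [|by clear -sy sy'; lia|].
    by rewrite /row_of !ifT//; clear -sy sy'; lia.
  by rewrite sy' at_y /row_of ifT//; clear -sy'; lia.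
- case: (leqP (a + b) (s + x)) => sx; first by rewrite !late//; clear -sx; lia.
  have [|_] := mono s (a + b - x); first by clear -sx; lia.
  by rewrite [row_of _ _ _ (a + b - x)]late; clear -sx sab; lia.
Qed.

Lemma path_of_row_of : path_of x y (row_of x y Q) = Q.
Proof.
have [sz nl] := size_paths.
apply: (@eq_from_nth _ (x, 0)); rewrite size_map size_iota // => m mL.
rewrite (nth_map 0) ?size_iota// nth_iota// /row_of ifF; last by clear; lia.
rewrite addKn; have := paths_nth m; rewrite sz => /(_ mL).
case: (nth _ _ _) => i j /= E; congr (_, _); clear -E; lia.
Qed.

End OnePath.

(** * Osculation as a strict order on the edges *)

Section TwoRows.
Variables (x y x' y' : nat) (f g : nat -> nat).
Hypotheses (x1 : 0 < x) (xx : x < x') (xa : x' <= a).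
Hypotheses (y1 : 0 < y) (yy : y < y') (yb : y' <= b).
Hypotheses (fP : lattice_row x y f) (gP : lattice_row x' y' g).

Let x1' : 0 < x'. Proof. by clear -xx; lia. Qed.
Let y1' : 0 < y'. Proof. by clear -yy; lia. Qed.

(** After a common point the first path goes up and the second right, and unit steps prevent a
    crossing elsewhere. Hence [f <= g], with equality never on two consecutive diagonals. *)
Lemma osculating_below : osculating (path_of x y f) (path_of x' y' g) -> below_row f g.
Proof.
move=> osc.
have meet s : f s = g s -> f s.+1 < g s.+1.
  (* Rays meet neither each other nor the other path, so a meeting is at genuine points of both
     paths and [osc] applies. *)
  move=> E; have ys : y' <= s.
    rewrite leqNgt; apply/negP => lt; have := row_early _ _ _ gP _ (ltnW lt).
    case: (leqP s y) => sy; first by have := row_early _ _ _ fP _ sy; clear -E sy lt yy; lia.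
    by have := row_le_a _ _ _ fP _ (ltnW sy); clear -E lt; lia.
  have sx : s + x' <= a + b.
    rewrite leqNgt; apply/negP => lt; have := row_late _ _ _ x1' gP _ (ltnW lt).
    case: (leqP (s + x) (a + b)) => sx; first by have := row_col _ _ _ x1 fP _ sx; clear -E lt; lia.
    by have := row_late _ _ _ x1 fP _ (ltnW sx); clear -E xx; lia.
  have [||_ up _ right] := osc (s - y) (s - y') (f s) (f s + s - a).
  - by rewrite onth_path_of subnKC ?ifT//; clear -ys yy sx xx; lia.
  - by rewrite E onth_path_of subnKC ?ifT//; clear -ys yy sx xx; lia.
  move: up; rewrite onth_path_of; case: ifP => // _ [].
  have -> : y + (s - y).+1 = s.+1 by clear -ys yy; lia.
  have := row_ge _ _ _ x1 fP s => ge up _.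
  case: (leqP (a + b) (s + x')) => sx'.
    rewrite [g s.+1](row_late _ _ _ x1' gP); last by clear -sx'; lia.
    by have := row_late _ _ _ x1' gP _ sx'; clear -E up ge x1; lia.
  have lt : (s - y').+1 <= a + b - x' - y' by clear -ys sx'; lia.
  move: right; rewrite size_path_of onth_path_of ltnS lt => /(_ isT) []; have -> : y' + (s - y').+1 = s.+1 by clear -ys; lia.
  by clear -up ge x1; lia.
have le s : f s <= g s.
  elim: s => [|s IH]; first by rewrite (row_first _ _ _ fP) (row_first _ _ _ gP); clear -yy; lia.
  have := meet s; have := row_step _ _ _ fP s; have := row_step _ _ _ gP s; clear -IH; lia.
by move=> s; have := meet s; have := le s; have := le s.+1; clear; lia.
Qed.

(** At a common point the strict inequalities for the edges just before and just after it leave only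
    one choice for each of the four steps. *)
Lemma below_osculating : below_row f g -> osculating (path_of x y f) (path_of x' y' g).
Proof.
move=> lt m m' i j; rewrite !onth_path_of.
case: (leqP m (a + b - x - y)) => // mL [iE jE].
case: (leqP m' (a + b - x' - y')) => // mL' [iE' jE'].
have gef := row_col_ge _ _ _ fP (y + m); have geg := row_col_ge _ _ _ gP (y' + m').
have mm : y' + m' = y + m by clear -iE jE iE' jE' y1 yy gef geg; lia.
rewrite mm in iE' jE' geg.
have m0 : 0 < m by clear -mm yy; lia.
have pE : y + m = (y + m.-1).+1 by clear -m0; lia.
have Lf := lt (y + m.-1); rewrite -pE in Lf.
have Sf := row_step _ _ _ fP (y + m.-1); have Sg := row_step _ _ _ gP (y + m.-1).
rewrite -pE in Sf Sg.
have Lf' := lt (y + m).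
have Sf' := row_step _ _ _ fP (y + m); have Sg' := row_step _ _ _ gP (y + m).
split.
- split=> //; rewrite ifT; last by clear -mL; lia.
  by congr (Some (_, _)); clear -Lf Sf Sg iE iE' jE m0; lia.
- rewrite ifT; last by clear -mL' mm xx yy xa yb; lia.
  by rewrite addnS; congr (Some (_, _)); clear -Lf' Sf' Sg' iE iE' jE; lia.
- move=> m0'; rewrite ifT; last by clear -mL'; lia.
  have -> : y' + m'.-1 = y + m.-1 by clear -mm m0 m0'; lia.
  by congr (Some (_, _)); clear -Lf Sf Sg iE iE' jE' m0; lia.
- rewrite size_path_of => mL''; rewrite ifT; last by clear -mL''; lia.
  rewrite addnS mm.
  by congr (Some (_, _)); clear -Lf' Sf' Sg' iE iE' jE' geg y1'; lia.
Qed.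

End TwoRows.
End Rows.

(** * Used edges on the diagonals *)

Lemma nth_filter_iota (p : pred nat) N k x :
  k < size (seq.filter p (iota 0 N)) -> x <= N ->
  (nth 0 (seq.filter p (iota 0 N)) k < x) = (k < count p (iota 0 x)).
Proof.
move=> kL /subnKC E; move: kL; rewrite -E iotaD filter_cat nth_cat size_cat !size_filter add0n => kL.
case: (ltnP k (count p (iota 0 x))) => kx.
  have : nth 0 (seq.filter p (iota 0 x)) k \in (seq.filter p (iota 0 x)).
    by rewrite mem_nth ?size_filter.
  by rewrite mem_filter mem_iota => /and3P[_ _ ->].
have : nth 0 (seq.filter p (iota x (N - x))) (k - count p (iota 0 x)) \in (seq.filter p (iota x (N - x))).
  by rewrite mem_nth// size_filter ltn_subLR.
by rewrite mem_filter mem_iota => /and3P[_ + _]; rewrite leqNgt => /negbTE.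
Qed.

Lemma nat_nthP (t : seq nat) (x : nat) :
  reflect (exists2 k : nat, k < size t & nth 0 t k = x :> nat) (x \in t).
Proof. exact: nthP. Qed.

(** An edge number [e = f s + f s.+1] decodes as [f s = uphalf e] and [f s.+1 = half e]: the edges
    leaving row [i] are 2i - 1 and 2i, those entering it 2i and 2i + 1. *)
Lemma count_uphalf (t : seq nat) i : uniq t -> 0 < i ->
  count (fun e => uphalf e == i) t = (i.*2.-1 \in t) + (i.*2 \in t).
Proof.
move=> ut i0; rewrite -!count_uniq_mem// -count_predUI addnC.
rewrite (@eq_count _ (predI _ _) pred0) ?count_pred0 ?add0n => [|e /=]; last by clear -i0; lia.
by apply: eq_count => e /=; clear -i0; lia.
Qed.

Lemma count_half (t : seq nat) i : uniq t ->
  count (fun e => half e == i) t = (i.*2 \in t) + (i.*2.+1 \in t).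
Proof.
move=> ut; rewrite -!count_uniq_mem// -count_predUI addnC.
rewrite (@eq_count _ (predI _ _) pred0) ?count_pred0 ?add0n => [|e /=]; last by clear; lia.
by apply: eq_count => e /=; clear; lia.
Qed.

Section Families.
Variables (a b : nat) (xs ys : seq nat).
Hypotheses (a_gt0 : 0 < a) (b_gt0 : 0 < b).
Hypotheses (xs_sorted : sorted ltn xs) (ys_sorted : sorted ltn ys).
Hypotheses (xsP : forall x, x \in xs -> 1 <= x <= a).
Hypotheses (ysP : forall y, y \in ys -> 1 <= y <= b).
Hypothesis xs_ys : size xs = size ys.

Let r := size xs.

Definition row_family (F : nat -> nat -> nat) : Prop :=
  (forall k, k < r -> lattice_row a b (nth 0 xs k) (nth 0 ys k) (F k)) /\
  (forall k, k.+1 < r -> below_row (F k) (F k.+1)).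

Definition levels (F : nat -> nat -> nat) (s : nat) : seq nat :=
  [seq F k s + F k s.+1 | k <- iota 0 r].

(* Prolongs the configuration (h, v) of the rectangle by the vertical rays in the
   columns ys and the horizontal rays in the rows xs; e numbers the edge between
   the diagonals s and s.+1 leaving row uphalf e. *)
Definition used (h v : nat -> nat -> bool) (s e : nat) : bool :=
  let i := uphalf e in let j := i + s - a in
  if a < i then odd e && (j \in ys)
  else if b < j then ~~ odd e && (i \in xs)
  else [&& 0 < i, 0 < j & if odd e then v i.-1 j else h i j].

Let xk k : k < r -> 0 < nth 0 xs k <= a.
Proof. by move=> kr; apply: xsP; apply: mem_nth. Qed.
Let yk k : k < r -> 0 < nth 0 ys k <= b.
Proof. by move=> kr; apply: ysP; apply: mem_nth; rewrite -xs_ys. Qed.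

Section OneFamily.
Variable (F : nat -> nat -> nat) (FP : row_family F).

Let FPk k : k < r -> lattice_row a b (nth 0 xs k) (nth 0 ys k) (F k).
Proof. by case: FP => H _; apply: H. Qed.

Lemma levels_sorted s : sorted ltn (levels F s).
Proof.
apply/(sortedP 0) => k; rewrite size_map size_iota => kr.
rewrite !(nth_map 0) ?size_iota// ?(ltnW kr)// !nth_iota ?(ltnW kr)// !add0n.
by case: FP => _ H; apply: (H k kr s).
Qed.

Lemma levels_uniq s : uniq (levels F s).
Proof. exact: (sorted_uniq ltn_trans ltnn (levels_sorted s)). Qed.

Lemma levelsP s e : reflect (exists2 k, k < r & e = F k s + F k s.+1) (e \in levels F s).
Proof.
by apply: (iffP mapP) => -[k]; rewrite ?mem_iota => kr ->; exists k; rewrite ?mem_iota.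
Qed.

Lemma count_out s i : 0 < i ->
  count (fun k => F k s == i) (iota 0 r) = (i.*2.-1 \in levels F s) + (i.*2 \in levels F s).
Proof.
move=> i0; rewrite -count_uphalf ?levels_uniq// count_map.
apply: eq_in_count => k; rewrite mem_iota /= => kr.
by have := row_step _ _ _ _ _ (FPk k kr) s; clear; lia.
Qed.

Lemma count_in s i :
  count (fun k => F k s.+1 == i) (iota 0 r) = (i.*2 \in levels F s) + (i.*2.+1 \in levels F s).
Proof.
rewrite -count_half ?levels_uniq// count_map.
apply: eq_in_count => k; rewrite mem_iota /= => kr.
by have := row_step _ _ _ _ _ (FPk k kr) s; clear; lia.
Qed.

(** [H] and [V] stand for the edges right of and below (i, j). The latter is the step up from (i +
    1, j), hence its diagonal and its number 2(i + 1) - 1. *)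
Let H i j := i.*2 \in levels F (j + a - i).
Let V i j := i.*2.+1 \in levels F (j + a - i.+1).

Lemma level_left i : i < a -> H i.+1 0 = false.
Proof.
move=> ia; apply/levelsP => -[k kr E].
have /andP[x0 xa] := xk k kr; have /andP[y0 yb] := yk k kr.
have := row_step _ _ _ _ _ (FPk k kr) (0 + a - i.+1).
have := row_col_ge _ _ _ _ _ (FPk k kr) (0 + a - i.+1).
by clear -ia E y0; lia.
Qed.

Lemma level_top j : V 0 j = false.
Proof.
apply/levelsP => -[k kr E].
have /andP[x0 xa] := xk k kr.
have := row_ge _ _ _ _ _ x0 (FPk k kr) (j + a - 1).
have := row_ge _ _ _ _ _ x0 (FPk k kr) (j + a - 1).+1.
by clear -E x0; lia.
Qed.

Lemma level_bottom j : V a j.+1 = (j.+1 \in ys).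
Proof.
rewrite /V; have -> : j.+1 + a - a.+1 = j by clear; lia.
apply/levelsP/nat_nthP; rewrite -xs_ys => -[k kr E]; exists k => //.
  have /andP[y0 yb] := yk k kr.
  have := row_step _ _ _ _ _ (FPk k kr) j.
  case: (leqP (nth 0 ys k) j) => jy.
    by have := row_le_a _ _ _ _ _ (FPk k kr) _ jy; clear -E; lia.
  have := row_early _ _ _ _ _ (FPk k kr) _ (ltnW jy); clear -E jy; lia.
rewrite !(row_early _ _ _ _ _ (FPk k kr)) ?E//; clear; lia.
Qed.

Lemma level_right i : i < a -> H i.+1 b = (i.+1 \in xs).
Proof.
move=> ia; rewrite /H; apply/levelsP/nat_nthP => -[k kr E]; exists k => //;
  have /andP[x0 xa] := xk k kr.
  have := row_step _ _ _ _ _ (FPk k kr) (b + a - i.+1).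
  case: (leqP ((b + a - i.+1).+1 + nth 0 xs k) (a + b)) => jx.
    by have := row_col _ _ _ _ _ x0 (FPk k kr) _ jx; clear -E ia jx; lia.
  have := row_late _ _ _ _ _ x0 (FPk k kr) _ (ltnW jx); clear -E jx; lia.
rewrite !(row_late _ _ _ _ _ x0 (FPk k kr)) ?E; clear -ia; lia.
Qed.

Lemma vertex_count i j : i < a ->
  let n := count (fun k => F k (j.+1 + a - i.+1) == i.+1) (iota 0 r) in
  n = V i j.+1 + H i.+1 j.+1 /\ n = H i.+1 j + V i.+1 j.+1.
Proof.
move=> ia /=; split; first by rewrite count_out// /V /H doubleS.
have E : j.+1 + a - i.+1 = (j + a - i.+1).+1 by clear -ia; lia.
by rewrite E count_in /V /H; congr (_ + (_ \in levels F _)); clear; lia.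
Qed.

Variable Z : nat -> nat -> bool.
Hypothesis ZP : forall i j, i < a -> j < b ->
  Z i.+1 j.+1 = (count (fun k => F k (j.+1 + a - i.+1) == i.+1) (iota 0 r) != 1).

(** [H] and [V] satisfy the recursion of [edge_right] and [edge_below]: with one path through a
    point, one edge enters and one leaves, which gives the complements; with none or two, all four
    edges agree. *)
Lemma level_edges i j : i <= a -> j <= b ->
  (0 < i -> edge_right Z i j = H i j) /\ (0 < j -> edge_below Z i j = V i j).
Proof.
elim: i j => [|i IHi] j ia; first by split=> // _; rewrite level_top.
elim: j => [|j IHj] jb.
  by split=> // _; rewrite level_left// edge_right0.
have [[h _] [_ v]] := (IHj (ltnW jb), IHi j.+1 (ltnW ia) jb).
have {h}h := h isT; have {v}v := v isT.
have [n1 n2] := vertex_count i j ia; have := ZP i j ia jb.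
rewrite edge_rightS edge_belowS h v n1 => ->; rewrite n1 in n2; move: n2.
by case: (V i j.+1) (H i.+1 j.+1) (H i.+1 j) (V i.+1 j.+1) => [] [] [] [].
Qed.

Lemma level_good :
  [/\ forall i j, i < a -> j < b -> Z i.+1 j.+1 ->
        edge_right Z i.+1 j = edge_below Z i j.+1,
      forall j, j < b -> edge_below Z a j.+1 = (j.+1 \in ys)
    & forall i, i < a -> edge_right Z i.+1 b = (i.+1 \in xs)].
Proof.
split=> [i j ia jb|j jb|i ia].
- rewrite (ZP i j ia jb); have [n1 n2] := vertex_count i j ia.
  have [-> // _] := level_edges i.+1 j ia (ltnW jb).
  have [_ -> //] := level_edges i j.+1 (ltnW ia) jb.
  rewrite n1 in n2 *; move: n2.
  by case: (V i j.+1) (H i.+1 j.+1) (H i.+1 j) (V i.+1 j.+1) => [] [] [] [].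
- by have [_ -> //] := level_edges a j.+1 (leqnn _) jb; rewrite level_bottom.
- by have [-> // _] := level_edges i.+1 b ia (leqnn _); rewrite level_right.
Qed.

Lemma levels_used s e : (e \in levels F s) = used (edge_right Z) (edge_below Z) s e.
Proof.
rewrite /used; case: ifP => ia.
  apply/levelsP/andP => [[k kr E]|[oe /nat_nthP[k]]].
    have := row_step _ _ _ _ _ (FPk k kr) s.
    have := row_up _ _ _ _ _ (FPk k kr) s.
    case: (leqP (nth 0 ys k) s) => sy.
      by have := row_le_a _ _ _ _ _ (FPk k kr) _ sy; clear -E ia; lia.
    have := row_early _ _ _ _ _ (FPk k kr) _ (ltnW sy) => rE up st.
    split; first by clear -E ia up st; lia.
    apply/nat_nthP; exists k; rewrite -?xs_ys//; clear -E up st rE sy ia; lia.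
  rewrite -xs_ys => kr jE; exists k => //.
  rewrite !(row_early _ _ _ _ _ (FPk k kr)); clear -jE ia oe; lia.
case: ifP => jb.
  apply/levelsP/andP => [[k kr E]|[oe /nat_nthP[k kr jE]]].
    have /andP[x0 xa] := xk k kr.
    have := row_step _ _ _ _ _ (FPk k kr) s.
    have := row_right _ _ _ _ _ (FPk k kr) s.
    case: (leqP (s + nth 0 xs k) (a + b)) => sx.
      by have := row_col _ _ _ _ _ x0 (FPk k kr) _ sx; clear -E ia jb; lia.
    have := row_late _ _ _ _ _ x0 (FPk k kr) _ (ltnW sx) => rE up st.
    split; first by clear -E ia jb up st; lia.
    apply/nat_nthP; exists k => //; clear -E up st rE sx ia jb; lia.
  have /andP[x0 xa] := xk k kr; exists k => //.
  rewrite !(row_late _ _ _ _ _ x0 (FPk k kr)); clear -jE ia jb oe; lia.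
case: (posnP (uphalf e)) => i0 /=.
  apply/levelsP => -[k kr E]; have /andP[x0 xa] := xk k kr.
  by have := row_ge _ _ _ _ _ x0 (FPk k kr) s; clear -x0 E i0; lia.
case: (posnP (uphalf e + s - a)) => j0 /=.
  apply/levelsP => -[k kr E]; have /andP[y0 yb] := yk k kr.
  have := row_step _ _ _ _ _ (FPk k kr) s.
  by have := row_col_ge _ _ _ _ _ (FPk k kr) s; clear -y0 E j0; lia.
case: ifP => oe.
  have [||_ ->//] := level_edges (uphalf e).-1 (uphalf e + s - a); [clear -ia jb; lia..|].
  by rewrite /V; congr (_ \in levels F _); clear -i0 j0 oe; lia.
have [||-> // _] := level_edges (uphalf e) (uphalf e + s - a); [clear -ia jb; lia..|].
by rewrite /H; congr (_ \in levels F _); clear -i0 j0 oe; lia.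
Qed.

End OneFamily.

(** * Recovering the rows from a balanced edge configuration *)

Section Flux.
Variables h v : nat -> nat -> bool.
Hypotheses (h0 : forall i, h i 0 = false) (v0 : forall j, v 0 j = false).
Hypothesis hv : forall i j, i < a -> j < b ->
  h i.+1 j + v i.+1 j.+1 = h i.+1 j.+1 + v i j.+1.
Hypothesis v_bottom : forall j, j < b -> v a j.+1 = (j.+1 \in ys).
Hypothesis h_right : forall i, i < a -> h i.+1 b = (i.+1 \in xs).

Let U := used h v.

Let ysN y : b < y -> (y \in ys) = false.
Proof. by move=> yb; apply/negP => /ysP/andP[_]; rewrite leqNgt yb. Qed.

(** Balance at the point in row [i.+1] of diagonal [s.+1], entering edges on the left. Where a ray
    is attached to the rectangle it comes from [v_bottom] or [h_right]. *)
Lemma used_vertex s i :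
  U s i.+1.*2 + U s i.+1.*2.+1 = U s.+1 i.+1.*2.-1 + U s.+1 i.+1.*2.
Proof.
rewrite /U /used.
have -> : uphalf i.+1.*2 = i.+1 by clear; lia.
have -> : uphalf i.+1.*2.+1 = i.+2 by clear; lia.
have -> : uphalf i.+1.*2.-1 = i.+1 by clear; lia.
have -> : odd i.+1.*2 = false by clear; lia.
have -> : odd i.+1.*2.+1 by clear; lia.
have -> : odd i.+1.*2.-1 by clear; lia.
rewrite /=; have -> : i.+2 + s - a = i.+1 + s.+1 - a by clear; lia.
case: (ltnP a i.+1) => ia; first by rewrite ifT ?addn0//; apply: ltnW.
case: (ltnP b (i.+1 + s.+1 - a)) => jb.
  case: (ltnP a i.+2) => ia'.
    rewrite ysN// addn0; case: ifP => // jb'.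
    have jE : i.+1 + s - a = b by clear -jb jb'; lia.
    by rewrite jE b_gt0 /= h_right.
  rewrite addn0; case: ifP => // jb'.
  have jE : i.+1 + s - a = b by clear -jb jb'; lia.
  by rewrite jE b_gt0 /= h_right.
rewrite [b < i.+1 + s - a]ltnNge (_ : i.+1 + s - a <= b) /=; last by clear -jb; lia.
case: (posnP (i.+1 + s.+1 - a)) => j0.
  have -> : i.+1 + s - a = 0 by clear -j0; lia.
  by have -> : (a < i.+2) = false by clear -j0; lia.
case jE: (i.+1 + s.+1 - a) j0 => [//|j] _; rewrite jE in jb.
have -> : i.+1 + s - a = j by clear -jE; lia.
have hj : (0 < j) && h i.+1 j = h i.+1 j by case: (j) => //; rewrite h0.
rewrite hj addnC [in RHS]addnC -hv// addnC; congr (_ + _).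
case: (ltnP a i.+2) => ia' /=; last by [].
have <- : a = i.+1 by clear -ia ia'; lia.
by rewrite v_bottom.
Qed.

(* Each point has as many incoming as outgoing edges, so the numbers of edges
   entering and leaving the rows < i of a diagonal agree: this makes the k-th
   incoming and the k-th outgoing edge share their point. *)
Lemma used_flux s i : count (U s) (iota 0 i.*2) = count (U s.+1) (iota 0 i.*2.-1).
Proof.
have low s' : U s' 0 = false /\ U s' 1 = false.
  rewrite /U /used /= v0 andbF [a < 1]ltnNge a_gt0.
  by split; case: ifP => // _; apply/negP => /xsP.
elim: i => [|[|i] IH] //; first by rewrite /= !(low _).1 (low _).2.
have -> : i.+2.*2 = i.+1.*2 + 2 by clear; lia.
have -> : (i.+1.*2 + 2).-1 = i.+1.*2.-1 + 2 by clear; lia.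
rewrite !iotaD !count_cat IH !add0n; congr (_ + _) => /=.
have -> : i.+1.*2.-1.+1 = i.+1.*2 by clear; lia.
by rewrite !addn0 used_vertex.
Qed.

Let N := (a + b).+1.*2.

Lemma used_bound s e : U s e -> e < N.-1.
Proof.
rewrite /U /used /N; case: ifP => ia; last by move=> _; clear -ia b_gt0; lia.
by case/andP=> oe /ysP; clear -ia oe; lia.
Qed.

Definition used_levels s : seq nat := [seq e <- iota 0 N | U s e].

Lemma mem_used_levels s e : (e \in used_levels s) = U s e.
Proof.
rewrite mem_filter mem_iota add0n andb_idr// => /used_bound.
by rewrite /N; clear; lia.
Qed.

Lemma used_levels_sorted s : sorted ltn (used_levels s).
Proof. by apply: sorted_filter (iota_ltn_sorted _ _); apply: ltn_trans. Qed.

Lemma used_levels_eq s t : sorted ltn t -> U s =1 mem t -> used_levels s = t.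
Proof.
move=> st E; apply: (irr_sorted_eq ltn_trans ltnn) => //; first exact: used_levels_sorted.
by move=> e; rewrite mem_used_levels E.
Qed.

Lemma used_levels_first : used_levels 0 = [seq (a + y).*2.-1 | y <- ys].
Proof.
apply: used_levels_eq.
  rewrite sorted_map; apply: sub_sorted ys_sorted => y z /=.
  by rewrite /relpre /=; clear -a_gt0; lia.
move=> e; rewrite /U /used addn0; apply/idP/mapP => [|[y yE ->]].
  case: ifP => ia; first by case/andP=> oe yE; exists (uphalf e - a) => //; clear -ia oe; lia.
  by have -> : uphalf e - a = 0 by [clear -ia; lia]; rewrite /= andbF.
have /andP[y0 yb] := ysP _ yE.
have -> : uphalf (a + y).*2.-1 = a + y by clear -a_gt0; lia.
rewrite addKn yE ifT; clear -y0; lia.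
Qed.

Lemma used_levels_last : used_levels (a + b) = [seq x.*2 | x <- xs].
Proof.
apply: used_levels_eq.
  rewrite sorted_map; apply: sub_sorted xs_sorted => y z /=.
  by rewrite /relpre /=; clear; lia.
move=> e; rewrite /U /used; apply/idP/mapP => [|[x xE ->]].
  case: ifP => ia.
    by rewrite ysN ?andbF//; clear -ia; lia.
  case: ifP => jb; first by case/andP=> oe xE; exists (uphalf e) => //; clear -oe; lia.
  by case: posnP => //= i0; clear -i0 jb; lia.
have /andP[x0 xa] := xsP _ xE.
have -> : uphalf x.*2 = x by clear; lia.
rewrite xE ifF; last by clear -xa; lia.
rewrite ifT; clear -x0; lia.
Qed.

Lemma size_used_levels s : size (used_levels s) = r.
Proof.
elim: s => [|s <-]; first by rewrite used_levels_first size_map /r xs_ys.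
(* The flux compares all [N] numbers on one level with the first [N.-1] on the next; [used_bound]
   excludes the remaining one. *)
rewrite /used_levels !size_filter -/N (used_flux s (a + b).+1) -/N.
have -> : iota 0 N = iota 0 (N.-1 + 1) by congr iota; clear; rewrite /N; lia.
rewrite iotaD count_cat add0n [X in _ + X = _](_ : _ = 0) ?addn0//.
rewrite [LHS]addn0; case E: (U _ _) => //.
by have := used_bound _ _ E; rewrite ltnn.
Qed.

Definition used_rows k s : nat := uphalf (nth 0 (used_levels s) k).

Lemma used_level_mem s k : k < r -> U s (nth 0 (used_levels s) k).
Proof. by move=> kr; rewrite -mem_used_levels mem_nth// size_used_levels. Qed.

Lemma used_rowsS k s : k < r -> used_rows k s.+1 = half (nth 0 (used_levels s) k).
Proof.
move=> kr; apply: eq_of_ltn => i; rewrite /used_rows.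
have := used_bound _ _ (used_level_mem s k kr).
have := used_bound _ _ (used_level_mem s.+1 k kr).
case: (leqP i (a + b)) => iN.
  have lt x s' : x <= N -> (nth 0 (used_levels s') k < x) = (k < count (U s') (iota 0 x)).
    by move=> xN; apply: nth_filter_iota => //; rewrite size_used_levels.
  have : (nth 0 (used_levels s) k < i.+1.*2) = (nth 0 (used_levels s.+1) k < i.+1.*2.-1).
    by rewrite !lt ?used_flux//; rewrite /N; clear -iN; lia.
  by clear; lia.
by rewrite /N; clear -iN; lia.
Qed.

Lemma used_rowsE k s : k < r -> used_rows k s + used_rows k s.+1 = nth 0 (used_levels s) k.
Proof. by move=> kr; rewrite used_rowsS// /used_rows; clear; lia. Qed.

Lemma used_rows_levels s : levels used_rows s = used_levels s.
Proof.
apply: (@eq_from_nth _ 0); rewrite size_map size_iota ?size_used_levels// => k kr.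
by rewrite (nth_map 0) ?size_iota// nth_iota// add0n used_rowsE.
Qed.

Lemma used_rows_family : row_family used_rows.
Proof.
split=> [k kr|k kr s]; last first.
  rewrite !used_rowsE ?(ltnW kr)//.
  by have /(sortedP 0) := used_levels_sorted s; apply; rewrite size_used_levels.
have st s := used_rowsS k s kr; have us s := used_level_mem s k kr.
split=> [||s|s|s].
- rewrite /used_rows used_levels_first (nth_map 0) -?xs_ys//; clear -a_gt0; lia.
- rewrite /used_rows used_levels_last (nth_map 0)//; clear; lia.
- by rewrite st /used_rows; clear; lia.
- move=> ia; have := us s; rewrite /U /used ifT// => /andP[oe _].
  by rewrite st /used_rows; clear -oe; lia.
- move=> jb; have := us s; rewrite /U /used -/(used_rows k s).
  rewrite st /used_rows in jb *; case: ifP => ia; first by rewrite ysN ?andbF//; clear -jb ia; lia.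
  rewrite ifT; last by clear -jb; lia.
  by case/andP=> oe _; clear -oe; lia.
Qed.

End Flux.
End Families.

(** * Path tuples and their vacancies and osculations *)

Lemma card_eq_finset (T : finType) (A : {set T}) : ([set` A]%classic #= `I_#|A|)%card.
Proof.
have -> : [set` A]%classic = [set` [fset x in enum A]%fset]%classic.
  by apply/seteqP; split=> x /=; rewrite !inE mem_enum.
apply/card_eq_fsetP; rewrite cardE; apply/perm_size/uniq_perm.
- exact: fset_uniq.
- exact: enum_uniq.
- by move=> x; rewrite inE.
Qed.

Lemma count_nth_iota (T : Type) (x0 : T) (p : pred T) (t : seq T) (n : nat) :
  size t = n -> count p t = count (fun k => p (nth x0 t k)) (iota 0 n).
Proof. by move=> <-; rewrite -{1}(mkseq_nth x0 t) count_map. Qed.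

Section Paths.
Variables (a b : nat) (a_gt0 : 0 < a) (b_gt0 : 0 < b).
Variables (alpha beta : {fset nat}) (ab_BP : BP a b (alpha, beta)).

Let xs := sorted_elts alpha.
Let ys := sorted_elts beta.
Let r := size xs.

Let xs_sorted : sorted ltn xs. Proof. exact: sorted_elts_ltn. Qed.
Let ys_sorted : sorted ltn ys. Proof. exact: sorted_elts_ltn. Qed.
Let xsP x : x \in xs -> 1 <= x <= a.
Proof. by rewrite mem_sorted_elts; case: ab_BP => H _ _; apply: H. Qed.
Let ysP y : y \in ys -> 1 <= y <= b.
Proof. by rewrite mem_sorted_elts; case: ab_BP => _ H _; apply: H. Qed.
Let xs_ys : size xs = size ys.
Proof. by rewrite !size_sorted_elts; case: ab_BP. Qed.
Let rE : r = #|` alpha|. Proof. exact: size_sorted_elts. Qed.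
Let xk k : k < r -> 0 < nth 0 xs k <= a.
Proof. by move=> kr; apply: xsP; apply: mem_nth. Qed.
Let yk k : k < r -> 0 < nth 0 ys k <= b.
Proof. by move=> kr; apply: ysP; apply: mem_nth; rewrite -xs_ys. Qed.
Let xkS k : k.+1 < r -> nth 0 xs k < nth 0 xs k.+1.
Proof. by have /(sortedP 0) := xs_sorted; apply. Qed.
Let ykS k : k.+1 < r -> nth 0 ys k < nth 0 ys k.+1.
Proof. by have /(sortedP 0) H := ys_sorted; move=> kr; apply: H; rewrite -xs_ys. Qed.

Definition rows (P : seq (seq (nat * nat))) k : nat -> nat :=
  row_of a (nth 0 xs k) (nth 0 ys k) (nth [::] P k).

Lemma OP_paths P k : OP a b alpha beta P -> k < r ->
  paths a b (nth 0 xs k) (nth 0 ys k) (nth [::] P k).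
Proof. by move=> [+ _] kr => /(_ k.+1); apply; rewrite -rE. Qed.

Lemma OP_path_of P k : OP a b alpha beta P -> k < r ->
  path_of a b (nth 0 xs k) (nth 0 ys k) (rows P k) = nth [::] P k.
Proof.
move=> O kr; have /andP[x0 xa] := xk k kr; have /andP[y0 yb] := yk k kr.
by apply: path_of_row_of => //; apply: OP_paths.
Qed.

Lemma OP_family P : OP a b alpha beta P -> row_family a b xs ys (rows P).
Proof.
move=> O; have lat k : k < r -> lattice_row a b (nth 0 xs k) (nth 0 ys k) (rows P k).
  move=> kr; have /andP[x0 xa] := xk k kr; have /andP[y0 yb] := yk k kr.
  by apply: row_of_lattice => //; apply: OP_paths.
split=> // k kr; have kr' := ltnW kr.
have /andP[x0 _] := xk k kr'.
apply: (osculating_below _ _ _ _ _ _ _ _ x0 (xkS k kr) (ykS k kr) (lat k kr') (lat k.+1 kr)).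
rewrite !OP_path_of//; have [_ /(_ k.+1)] := O; apply.
by rewrite -rE /r /=; clear -kr; lia.
Qed.

Definition paths_of (F : nat -> nat -> nat) : (#|` alpha|).-tuple (seq (nat * nat)) :=
  [tuple path_of a b (nth 0 xs k) (nth 0 ys k) (F k) | k < #|` alpha|].

Lemma nth_paths_of F k : k < r ->
  nth [::] (paths_of F) k = path_of a b (nth 0 xs k) (nth 0 ys k) (F k).
Proof. by rewrite rE => kr; rewrite -[k]/(val (Ordinal kr)) -tnth_nth tnth_mktuple. Qed.

Lemma paths_of_OP F : row_family a b xs ys F -> OP a b alpha beta (paths_of F).
Proof.
move=> [lat osc]; split=> -[//|k] /= kr.
  have {}kr : k < r by rewrite rE.
  have /andP[x0 xa] := xk k kr; have /andP[y0 yb] := yk k kr.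
  by rewrite /kth_path /= nth_paths_of//; apply: path_of_paths => //; apply: lat.
have {}kr : k.+1 < r by rewrite rE; case: #|` alpha| kr.
have kr' := ltnW kr.
have /andP[x0 _] := xk k kr'; have /andP[_ xa] := xk k.+1 kr.
have /andP[y0 _] := yk k kr'; have /andP[_ yb] := yk k.+1 kr.
rewrite /kth_path /= !nth_paths_of//.
exact: (below_osculating _ _ _ _ _ _ _ _ (xkS k kr) xa y0 (ykS k kr) yb
  (lat k kr') (lat k.+1 kr) (osc k kr)).
Qed.

Lemma rows_paths_of F k : row_family a b xs ys F -> k < r -> rows (paths_of F) k = F k.
Proof.
move=> [lat osc] kr; have /andP[x0 xa] := xk k kr; have /andP[y0 yb] := yk k kr.
by rewrite /rows nth_paths_of//; apply: row_of_path_of => //; apply: lat.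
Qed.

Notation cell := ('I_a * 'I_b)%type.

Definition Zcells (P : seq (seq (nat * nat))) : {set cell} :=
  [set p | count (fun Q => cell_point a b p \in Q) P != 1].

Lemma count_through P i j : OP a b alpha beta P -> i < a -> j < b ->
  count (fun Q => (i.+1, j.+1) \in Q) P =
  count (fun k => rows P k (j.+1 + a - i.+1) == i.+1) (iota 0 r).
Proof.
move=> O ia jb; rewrite (count_nth_iota _ [::] _ _ r); last by rewrite size_tuple rE.
apply: eq_in_count => k; rewrite mem_iota => /= kr.
have /andP[x0 xa] := xk k kr; have /andP[y0 yb] := yk k kr.
have [lat _] := OP_family _ O.
by rewrite -OP_path_of//; apply: mem_path_of => //; apply: lat.
Qed.

Lemma in_ZcellsE P i j : OP a b alpha beta P -> i < a -> j < b ->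
  in_cells a b (Zcells P) i.+1 j.+1 =
  (count (fun k => rows P k (j.+1 + a - i.+1) == i.+1) (iota 0 r) != 1).
Proof.
move=> O ia jb; rewrite -count_through//.
by rewrite (in_cellsE a b _ (Ordinal ia, Ordinal jb)) inE.
Qed.

Lemma Zset_card P l : OP a b alpha beta P -> (Zset a b P #= `I_l)%card <-> #|Zcells P| = l.
Proof.
move=> O; have -> : Zset a b P = (cell_point a b @` [set` Zcells P])%classic.
  have [FP _] := (OP_family _ O, tt).
  apply/seteqP; split.
    case=> -[|i] [|j] [] //= ia jb n.
    by exists (Ordinal ia, Ordinal jb) => //=; rewrite inE /cell_point /=; case: n => ->.
  move=> _ [[[i ia] [j jb]] /= pZ <-]; split=> //=; move: pZ; rewrite inE /cell_point /= count_through//.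
  (* The number of paths through a point is a sum of two bits, so [!= 1] means 0 or 2. *)
  have [-> _] := vertex_count _ _ _ _ _ FP i j ia.
  by case: (_ \in _) (_ \in _) => [] []; [right|..|left].
have E : ((cell_point a b @` [set` Zcells P])%classic #= [set` Zcells P]%classic)%card.
  by apply: inj_card_eq => p q _ _; apply: cell_point_inj.
rewrite (card_eql E) (card_eql (card_eq_finset _ _)).
by split=> [/card_eq_II|/card_eq_II].
Qed.

Definition valid_cells (A : {set cell}) : Prop :=
  let Z := in_cells a b A in
  [/\ forall i j, i < a -> j < b -> Z i.+1 j.+1 ->
        edge_right Z i.+1 j = edge_below Z i j.+1,
      forall j, j < b -> edge_below Z a j.+1 = (j.+1 \in beta)
    & forall i, i < a -> edge_right Z i.+1 b = (i.+1 \in alpha)].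

Lemma Zcells_valid P : OP a b alpha beta P -> valid_cells (Zcells P).
Proof.
move=> O; have [Zeq Zb Zr] := level_good _ _ _ _ xsP ysP xs_ys _ (OP_family _ O) _
  (fun i j ia jb => in_ZcellsE P i j O ia jb).
by split=> // [j jb|i ia]; rewrite ?Zb ?Zr // mem_sorted_elts.
Qed.

(** By [levels_used] the set determines the used edges of each level, and their order tells which
    path uses which edge. Equal sums of consecutive rows with unit steps force equal rows. *)
Lemma Zcells_inj P P' : OP a b alpha beta P -> OP a b alpha beta P' ->
  Zcells P = Zcells P' -> P = P'.
Proof.
move=> O O' E; have [FP FP'] := (OP_family _ O, OP_family _ O').
have levE s : levels xs (rows P) s = levels xs (rows P') s.
  apply: (irr_sorted_eq ltn_trans ltnn); [exact: levels_sorted FP s|exact: levels_sorted FP' s|].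
  move=> e; rewrite (levels_used _ _ _ _ xsP ysP xs_ys _ FP _
    (fun i j ia jb => in_ZcellsE P i j O ia jb)) E.
  by rewrite -(levels_used _ _ _ _ xsP ysP xs_ys _ FP' _
    (fun i j ia jb => in_ZcellsE P' i j O' ia jb)).
have rowE k s : k < r -> rows P k s = rows P' k s.
  move=> kr; have : rows P k s + rows P k s.+1 = rows P' k s + rows P' k s.+1 :> nat.
    have := congr1 (nth 0 ^~ k) (levE s).
    by rewrite /= !(nth_map 0) ?size_iota// !nth_iota// !add0n.
  have [[lat _] [lat' _]] := (FP, FP').
  have := row_step _ _ _ _ _ (lat k kr) s; have := row_step _ _ _ _ _ (lat' k kr) s.
  by clear; lia.
apply/val_inj/(@eq_from_nth _ [::]); rewrite !size_tuple// => k kr.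
have {}kr : k < r by rewrite rE.
rewrite -(OP_path_of P)// -(OP_path_of P')//; congr path_of.
by apply/funext => s; apply: rowE.
Qed.

(** Both rules of the recursion balance entering and leaving edges, so the flux construction gives a
    path family. Equality of left and upper edges on [A] makes the number of paths there 0 or 2. *)
Lemma Zcells_onto A : valid_cells A -> exists2 P, OP a b alpha beta P & Zcells P = A.
Proof.
case; set Z := in_cells a b A; set h := edge_right Z; set v := edge_below Z => Zeq Zb Zr.
have hv i j : i < a -> j < b -> h i.+1 j + v i.+1 j.+1 = h i.+1 j.+1 + v i j.+1.
  rewrite /h /v edge_rightS edge_belowS; case: ifP => // _ _ _.
  by do 2!case: (_ _ _ _).
have {}Zb j : j < b -> v a j.+1 = (j.+1 \in ys) by rewrite mem_sorted_elts; apply: Zb.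
have {}Zr i : i < a -> h i.+1 b = (i.+1 \in xs) by rewrite mem_sorted_elts; apply: Zr.
have h0 i : h i 0 = false by apply: edge_right0.
have v0 j : v 0 j = false by [].
pose F := used_rows a b xs ys h v.
have FP : row_family a b xs ys F by apply: used_rows_family.
have O := paths_of_OP _ FP; exists (paths_of F) => //.
apply/setP => -[[i ia] [j jb]]; rewrite inE (count_through _ i j O ia jb).
rewrite (@eq_in_count _ _ (fun k => F k (j.+1 + a - i.+1) == i.+1)); last first.
  by move=> k; rewrite mem_iota => /= kr; rewrite rows_paths_of.
have [-> _] := vertex_count _ _ _ _ _ FP i j ia.
rewrite !(used_rows_levels _ _ _ _ a_gt0 b_gt0 ys_sorted xsP ysP xs_ys _ _ h0 v0 hv Zb Zr).
rewrite !mem_used_levels// /used.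
have -> : uphalf i.*2.+1 = i.+1 by clear; lia.
have -> : uphalf i.+1.*2 = i.+1 by clear; lia.
have -> : i.+1 + (j.+1 + a - i.+1) - a = j.+1 by clear -ia; lia.
have -> : odd i.*2.+1 by clear; lia.
have -> : odd i.+1.*2 = false by clear; lia.
rewrite [a < _]ltnNge ia [b < _]ltnNge jb /=.
rewrite -(in_cellsE a b A (Ordinal ia, Ordinal jb)) -[in_cells _ _ _ _ _]/(Z i.+1 j.+1).
rewrite -/v; case Zij: (Z i.+1 j.+1); last by case: (v i j.+1).
by have /= -> := Zeq i j ia jb Zij; case: (v i j.+1).
Qed.

Lemma card_OPl l :
  (OPl a b alpha beta l #= `I_#|[set A | `[< valid_cells A >] && (#|A| == l)]|)%card.
Proof.
have inj : {in OPl a b alpha beta l &, injective (fun P => Zcells (tval P))}.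
  by move=> P P'; rewrite !inE => -[O _] [O' _]; apply: Zcells_inj.
set S := [set A | _]; rewrite -(card_eql (inj_card_eq inj)) -(card_eqr (card_eq_finset _ S)).
rewrite (_ : (_ @` _)%classic = [set` S]%classic) ?card_eqxx//.
apply/seteqP; split=> [_ [P [O Pl] <-]|A] /=; rewrite inE.
  apply/andP; split; first by apply/asboolP/Zcells_valid.
  by apply/eqP/Zset_card.
case/andP=> /asboolP/Zcells_onto[P O <-] /eqP PZ.
by exists P => //; split=> //; apply/Zset_card.
Qed.

(** * Valid sets and oscillating tableaux with the same word *)

Section Words.
Variables (prec : rel int) (prec_q : q_order (b%:Z - a%:Z)%R prec).

Lemma valid_cells_word A : valid_cells A <->
  admissible vacuum (cell_word a b prec A) /\
  maya (lambda_of a b alpha beta) = run vacuum (cell_word a b prec A).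
Proof.
rewrite (maya_lambda_of _ _ _ _ ab_BP) (cell_word_admissible _ _ a_gt0 b_gt0 _ prec_q).
split=> [[Zeq Zb Zr]|[/forall_inP Zeq E]].
  split; last by apply/esym/funext/(cell_word_run _ _ a_gt0 b_gt0 _ prec_q).
  apply/forall_inP => -[[i ia] [j jb]] pA; apply/eqP/Zeq => //.
  by rewrite (in_cellsE a b A (Ordinal ia, Ordinal jb)).
have [|Zb Zr] := proj1 (cell_word_run _ _ a_gt0 b_gt0 _ prec_q A alpha beta).
  by rewrite E.
split=> // i j ia jb; rewrite (in_cellsE a b A (Ordinal ia, Ordinal jb)) => /Zeq.
by move/eqP.
Qed.

(** Double counting of the pairs of a tableau and a set with equal words: a set has one tableau if
    it is valid with [l] elements and none otherwise, while [card_cell_word] counts the sets of a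
    given tableau. *)
Lemma card_valid_cells l :
  #|[set A | `[< valid_cells A >] && (#|A| == l)]| =
  \big[addn/0]_(eta \in OT (lambda_of a b alpha beta) l) 'C(minn a b + ascents prec eta, l).
Proof.
rewrite fsbig_finite; last exact: OT_finite.
set S := fset_set _; have inS eta : (eta \in S) = `[< OT (lambda_of a b alpha beta) l eta >].
  by rewrite in_fset_set ?inE //; exact: OT_finite.
rewrite [RHS](eq_big_seq (fun eta => \sum_A (tableau_word eta == cell_word a b prec A))) => [|eta].
  rewrite exchange_big -sum1dep_card big_mkcond; apply: eq_bigr => A _ /=.
  transitivity (count (fun eta => tableau_word eta == cell_word a b prec A) S); last first.
    by rewrite -sum1_count big_mkcond; apply: eq_bigr => eta _; case: (_ == _).
  case: ifP => [/andP[/asboolP/valid_cells_word[adm E] /eqP Al]|nA].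
    have [] := tableau_exists l _ _ (lambda_of_partition _ _ _ _ ab_BP) _ adm E.
      by rewrite size_cell_word.
    move=> eta O wE; rewrite (@eq_in_count _ _ (pred1 eta)).
      by rewrite count_uniq_mem ?fset_uniq// inS; have -> : `[< OT (lambda_of a b alpha beta) l eta >] by apply/asboolP.
    move=> xi; rewrite inS => /asboolP O'; rewrite -wE; apply/eqP/eqP => [|-> //].
    exact: tableau_word_inj O' O.
  apply/esym/eqP; rewrite -leqn0 leqNgt -has_count; apply/hasPn => eta.
  rewrite inS => /asboolP O; apply/eqP => wE; move/negP: nA; apply; apply/andP; split.
    apply/asboolP/valid_cells_word; rewrite -wE; exact: tableau_admissible O.
  by rewrite -(size_cell_word a b prec) -wE size_tableau_word.
rewrite inS => /asboolP/tableau_admissible[adm _]; rewrite ascents_word.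
have := card_cell_word _ _ a_gt0 b_gt0 _ prec_q _ adm; rewrite size_tableau_word => <-.
rewrite -sum1dep_card big_mkcond; apply: eq_bigr => A _.
by rewrite eq_sym; case: (_ == _).
Qed.
End Words.
End Paths.

Theorem corollary14 (a b : nat) (a_gt0 : 0 < a) (b_gt0 : 0 < b)
    (alpha beta : {fset nat}) (ab_BP : BP a b (alpha, beta))
    (l : nat) (prec : rel int) (prec_q : q_order (b%:Z - a%:Z)%R prec) :
  (OPl a b alpha beta l #=
    `I_(\big[addn/0]_(eta \in OT (lambda_of a b alpha beta) l)
          'C(minn a b + ascents prec eta, l)))%card.
Proof.
rewrite -(card_valid_cells _ _ a_gt0 b_gt0 _ _ ab_BP _ prec_q).
exact: (card_OPl _ _ a_gt0 b_gt0 _ _ ab_BP).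
Qed.
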